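(* Let $(\mathcal{G},\mu,\gamma,\phi)$ be a finite-dimensional Lie quasi-bialgebra over $K$ and let $\mathcal{D}=\mathcal{G}\bowtie\mathcal{G}^*$ be its double. Then the linear map $$\mathcal{R}:\mathcal{D}\to \mathrm{End}(\Lambda\mathcal{G}),\qquad x+\xi\mapsto \mathcal{R}_x+\mathcal{R}_\xi,$$ defined by $$\mathcal{R}_x(Y)=d_\gamma(x)\wedge Y+ad^{\mu}_xY-\tfrac12\langle \xi^{\mu},x\rangle Y,$$ $$\mathcal{R}_\xi(Y)=-i_{d_\mu(\xi)}Y+ad^{\gamma *}_{\xi}Y-(i_\xi\phi)\wedge Y+\tfrac12\langle x^{\gamma},\xi\rangle Y,$$ for $x\in\mathcal{G}$, $\xi\in\mathcal{G}^*$ and $Y\in\Lambda\mathcal{G}$, is a representation of the Lie algebra $(\mathcal{D},[\,,]_{\mathcal{D}})$ on $\Lambda\mathcal{G}$.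
   Context: $K=\mathbb{R}$ or $\mathbb{C}$; $\mathcal{G}$ is a finite-dimensional $K$-vector space with dual $\mathcal{G}^*$. The pairing between $\Lambda\mathcal{G}^*$ and $\Lambda\mathcal{G}$ is $\langle \xi_1\wedge\dots\wedge\xi_m,x_1\wedge\dots\wedge x_n\rangle=\delta_{mn}\det(\langle\xi_i,x_j\rangle)$. For $A\in\Lambda\mathcal{G}^*$, $i_A\in \mathrm{End}(\Lambda\mathcal{G})$ is the transpose of left exterior multiplication by $A$: $\langle B,i_AY\rangle=\langle A\wedge B,Y\rangle$ for all $B\in\Lambda\mathcal{G}^*$. For $X\in\Lambda\mathcal{G}$, $i_X\in \mathrm{End}(\Lambda\mathcal{G}^* )$ is defined similarly. A Lie quasi-bialgebra is $(\mathcal{G},\mu,\gamma,\phi)$ with $\mu\in \mathrm{Hom}(\Lambda^2\mathcal{G},\mathcal{G})$, $\gamma\in \mathrm{Hom}(\mathcal{G},\Lambda^2\mathcal{G})$, $\phi\in\Lambda^3\mathcal{G}$ such that: (a) $(\mathcal{G},\mu)$ is a Lie algebra; (b) $\gamma$ is a 1-cocycle of $(\mathcal{G},\mu)$ with values in $\Lambda^2\mathcal{G}$ for the adjoint action, i.e. $\gamma(\mu(x,y))=x\cdot\gamma(y)-y\cdot\gamma(x)$; (c) $\frac12 Alt\big((\gamma\otimes1)\gamma(x)\big)=-x\cdot\phi$ for all $x\in\mathcal{G}$, where $x\cdot\phi$ is the adjoint action of $x$ on $\phi$; (d) $Alt\big((\gamma\otimes1\otimes1)(\phi)\big)=0$.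 Here $Alt(x_1\otimes\dots\otimes x_n)=\sum_\sigma \mathrm{sign}(\sigma)x_{\sigma(1)}\otimes\dots\otimes x_{\sigma(n)}$, and $\Lambda\mathcal{G}$ is viewed inside the tensor algebra by $x_1\wedge\dots\wedge x_n=Alt(x_1\otimes\dots\otimes x_n)$. The letter $\gamma$ also denotes the skew bracket on $\mathcal{G}^*$ given by $\langle\gamma(x),\xi\wedge\eta\rangle=-\langle x,\gamma(\xi,\eta)\rangle$. Notation: $ad^\mu_xy=\mu(x,y)$, $ad^\gamma_\xi\eta=\gamma(\xi,\eta)$, $\langle ad^{\mu *}_x\xi,y\rangle=-\langle\xi,\mu(x,y)\rangle$, $\langle ad^{\gamma *}_\xi x,\eta\rangle=-\langle x,\gamma(\xi,\eta)\rangle$; these operators are extended as degree-0 derivations of the exterior algebras ($ad^\mu_x$, $ad^{\gamma*}_\xi$ on $\Lambda\mathcal{G}$; $ad^{\mu*}_x$, $ad^\gamma_\xi$ on $\Lambda\mathcal{G}^*$). $\phi(\xi,\eta)=i_{\xi\wedge\eta}\phi\in\mathcal{G}$. The double $\mathcal{D}=\mathcal{G}\bowtie\mathcal{G}^*$ is the vector space $\mathcal{G}\oplus\mathcal{G}^*$ with the Lie bracket $[x,y]_{\mathcal{D}}=\mu(x,y)$, $[x,\xi]_{\mathcal{D}}=-ad^{\gamma *}_\xi x+ad^{\mu *}_x\xi$, $[\xi,\eta]_{\mathcal{D}}=\phi(\xi,\eta)+\gamma(\xi,\eta)$. $d_\mu(\xi)\in\Lambda^2\mathcal{G}^*$ and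 $d_\gamma(x)\in\Lambda^2\mathcal{G}$ are given by $\langle d_\mu(\xi),x\wedge y\rangle=-\langle\xi,\mu(x,y)\rangle$ and $\langle d_\gamma(x),\xi\wedge\eta\rangle=-\langle x,\gamma(\xi,\eta)\rangle$ (so $d_\gamma(x)=\gamma(x)$). The elements $\xi^\mu\in\mathcal{G}^*$, $x^\gamma\in\mathcal{G}$ are defined by $\langle\xi^\mu,x\rangle=\mathrm{tr}(ad^\mu_x\in \mathrm{End}(\mathcal{G}))$ and $\langle x^\gamma,\xi\rangle=\mathrm{tr}(ad^\gamma_\xi\in \mathrm{End}(\mathcal{G}^* ))$. *)

(* Defs.v *)
From HB Require Import structures.
From mathcomp Require Import all_boot all_order perm all_algebra.
From mathcomp Require Import reals complex.

Set Implicit Arguments.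
Unset Strict Implicit.
Unset Printing Implicit Defensive.

Import Order.TTheory GRing.Theory Num.Theory.
Local Open Scope ring_scope.

Variant scalar_kind := RealScalars | ComplexScalars.

Definition scalars (R : realType) (k : scalar_kind) : numFieldType :=
  match k with RealScalars => R | ComplexScalars => R[i]%C end.

(* The exterior algebra on n generators. The coefficient of a multivector at
   S = {i_1 < ... < i_k} is its coordinate on e_{i_1} /\ ... /\ e_{i_k}
   (see [blade_prod]); the exterior product is the ring product [*]. *)
Definition grassmann (K : fieldType) (n : nat) : Type :=
  {ffun {set 'I_n} -> K^o}.

Section Grassmann.
Variables (K : fieldType) (n : nat).
Implicit Types (S T U : {set 'I_n}) (A B C : grassmann K n).

HB.instance Definition _ := Vector.on (grassmann K n).

Definition inversions S T : nat :=
  (\sum_(i in S) \sum_(j in T) (j < i)%N)%N.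

Definition blade S : grassmann K n := [ffun T => (T == S)%:R].

Definition gmul A B : grassmann K n :=
  [ffun U => \sum_(S in powerset U)
     (-1) ^+ inversions S (U :\: S) * A S * B (U :\: S)].

Lemma inversionsUl S T U : [disjoint S & T] ->
  inversions (S :|: T) U = (inversions S U + inversions T U)%N.
Proof.
move=> dST; rewrite /inversions -bigU //.
by apply: eq_bigl => i; rewrite !inE.
Qed.

Lemma inversionsUr S T U : [disjoint T & U] ->
  inversions S (T :|: U) = (inversions S T + inversions S U)%N.
Proof.
move=> dTU; rewrite /inversions -big_split; apply: eq_bigr => i _ /=.
by rewrite -bigU //; apply: eq_bigl => j; rewrite !inE.
Qed.

Lemma inversions0l T : inversions set0 T = 0%N.
Proof. by rewrite /inversions big_set0. Qed.

Lemma inversions0r T : inversions T set0 = 0%N.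
Proof. by rewrite /inversions big1 // => i _; rewrite big_set0. Qed.

Lemma gmulA : associative gmul.
Proof.
move=> A B C; apply/ffunP => U; rewrite !ffunE.
under eq_bigr => S _ do rewrite ffunE big_distrr /=.
under [RHS]eq_bigr => S _ do rewrite ffunE big_distrr big_distrl /=.
rewrite [RHS](exchange_big_dep (mem (powerset U))) /=; last first.
  by move=> S T; rewrite !powersetE => sSU sTS; apply: subset_trans sTS sSU.
apply: eq_bigr => T; rewrite powersetE => sTU.
rewrite [RHS](reindex_onto (fun S => T :|: S) (fun S => S :\: T)) /=; last first.
  move=> S /andP[_]; rewrite powersetE => sTS.
  by rewrite setDE setUIr setUCr setIT; apply/setUidPr.
apply: eq_big => S.
  rewrite !powersetE subUset sTU subsetUl /= andbT subsetD.
  rewrite setDUl setDv set0U; congr (_ && _).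
  exact: (sameP setDidPl eqP).
rewrite powersetE subsetD => /andP[sSU dST].
have dTS : T :&: S = set0 by apply/eqP; rewrite setI_eq0 disjoint_sym.
have -> : (T :|: S) :\: T = S.
  by rewrite setDUl setDv set0U; apply/setDidPl.
rewrite setDDl; set W := U :\: (T :|: S).
have -> : U :\: T = S :|: W.
  apply/setP => i; rewrite !inE.
  have /setP/(_ i) := dTS; have := subsetP sSU i; rewrite !inE.
  by case: (i \in S); case: (i \in T); case: (i \in U) => // /(_ isT).
have dSW : [disjoint S & W].
  by rewrite -setI_eq0; apply/eqP/setP => i; rewrite !inE; case: (i \in S);
     rewrite ?orbT ?andbF.
rewrite inversionsUr // inversionsUl 1?disjoint_sym // !exprD !mulrA.
congr (_ * _); rewrite -!mulrA [A T * _]mulrCA [LHS]mulrCA; congr (_ * _).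
exact: mulrCA.
Qed.

Lemma gmul1l : left_id (blade set0) gmul.
Proof.
move=> A; apply/ffunP => U; rewrite ffunE (bigD1 set0) ?powersetE ?sub0set //=.
rewrite big1 ?addr0 => [|S /andP[_ /negPf nS]].
  by rewrite ffunE eqxx inversions0l setD0 !mul1r.
by rewrite ffunE nS mulr0 mul0r.
Qed.

Lemma gmul1r : right_id (blade set0) gmul.
Proof.
move=> A; apply/ffunP => U.
rewrite ffunE (bigD1 U) ?powersetE ?subxx //= setDv inversions0r.
rewrite [in X in X + _]ffunE eqxx mulr1 mul1r big1 ?addr0 // => S.
rewrite powersetE => /andP[sSU nSU].
rewrite [blade _ _]ffunE setD_eq0; case: (boolP (U \subset S)) => sUS.
  by rewrite eqEsubset sSU sUS in nSU.
exact: mulr0.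
Qed.

Lemma gmulDl : left_distributive gmul +%R.
Proof.
move=> A B C; apply/ffunP => U; rewrite !ffunE -big_split.
by apply: eq_bigr => S _; rewrite ffunE mulrDr mulrDl.
Qed.

Lemma gmulDr : right_distributive gmul +%R.
Proof.
move=> A B C; apply/ffunP => U; rewrite !ffunE -big_split.
by apply: eq_bigr => S _; rewrite ffunE mulrDr.
Qed.

Lemma blade0_neq0 : blade set0 != 0.
Proof.
apply/eqP => /ffunP/(_ set0); rewrite !ffunE eqxx => /eqP.
by rewrite oner_eq0.
Qed.

HB.instance Definition _ := GRing.Zmodule_isNzRing.Build (grassmann K n)
  gmulA gmul1l gmul1r gmulDl gmulDr blade0_neq0.

Lemma gscaleAl (a : K) A B : a *: (A * B) = (a *: A) * B.
Proof.
apply/ffunP => U; rewrite !ffunE scaler_sumr; apply: eq_bigr => S _.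
by rewrite ffunE scalerAl scalerAr.
Qed.

HB.instance Definition _ :=
  GRing.Lmodule_isLalgebra.Build K (grassmann K n) gscaleAl.

Lemma gscaleAr (a : K) A B : a *: (A * B) = A * (a *: B).
Proof.
apply/ffunP => U; rewrite !ffunE scaler_sumr; apply: eq_bigr => S _.
by rewrite ffunE scalerAr.
Qed.

HB.instance Definition _ :=
  GRing.Lalgebra_isAlgebra.Build K (grassmann K n) gscaleAr.

Definition gen (i : 'I_n) : grassmann K n := blade [set i].

Definition gvec (c : 'I_n -> K) : grassmann K n := \sum_i c i *: gen i.

(* Used with A in the exterior algebra of the dual space, whose generators
   are the dual basis; see [pairing_prod] for the determinant formula. *)
Definition pairing A B : K := \sum_S A S * B S.

Definition contraction A B : grassmann K n :=
  [ffun S => pairing (A * blade S) B].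

Definition homogeneous (k : nat) A : Prop := forall S, #|S| != k -> A S = 0.

Lemma grassmannE A : A = \sum_S A S *: blade S.
Proof.
apply/ffunP => T; rewrite sum_ffunE (bigD1 T) //= !ffunE eqxx.
rewrite [_ *: _]mulr1 big1 ?addr0 // => S nST.
by rewrite !ffunE eq_sym (negPf nST) [_ *: _]mulr0.
Qed.

Lemma gmulE A B U : (A * B) U = \sum_(S in powerset U)
  (-1) ^+ inversions S (U :\: S) * A S * B (U :\: S).
Proof. exact: ffunE. Qed.

Lemma gen_mulE i B T : (gen i * B) T =
  if i \in T then (-1) ^+ inversions [set i] (T :\ i) * B (T :\ i) else 0.
Proof.
rewrite gmulE; case: ifP => iT; last first.
  rewrite big1 // => S; rewrite powersetE ffunE => sST.
  case: eqP => [eS|_]; last by rewrite mulr0 mul0r.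
  by rewrite eS sub1set iT in sST.
rewrite (bigD1 [set i]) /= ?powersetE ?sub1set // ffunE eqxx mulr1.
rewrite big1 ?addr0 // => S /andP[_ /negPf nS].
by rewrite ffunE nS mulr0 mul0r.
Qed.

Lemma inversions1 i j : inversions [set i] [set j] = (j < i)%N.
Proof. by rewrite /inversions !big_set1. Qed.

Lemma inversions1D i j T : j \in T ->
  inversions [set i] T = ((j < i) + inversions [set i] (T :\ j))%N.
Proof. by move=> jT; rewrite /inversions !big_set1 (big_setD1 j). Qed.

Lemma blade_neq S T : (blade S) T = (T == S)%:R.
Proof. exact: ffunE. Qed.

Lemma pairing_is_linear A : scalar (pairing A).
Proof.
move=> a B C; rewrite /pairing mulr_sumr -big_split; apply: eq_bigr => S _ /=.
by rewrite !ffunE mulrDr; congr (_ + _); rewrite mulrCA.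
Qed.

HB.instance Definition _ A :=
  GRing.isLinear.Build K (grassmann K n) K *%R (pairing A)
    (@pairing_is_linear A).

Lemma pairingC A B : pairing A B = pairing B A.
Proof. by apply: eq_bigr => S _; rewrite mulrC. Qed.

Lemma pairing_blade S B : pairing (blade S) B = B S.
Proof.
rewrite /pairing (bigD1 S) //= blade_neq eqxx mul1r big1 ?addr0 // => T nTS.
by rewrite blade_neq (negPf nTS) mul0r.
Qed.

Lemma pairing_contraction A B Y :
  pairing B (contraction A Y) = pairing (A * B) Y.
Proof.
rewrite {2}[B]grassmannE mulr_sumr [RHS]pairingC linear_sum.
by apply: eq_bigr => S _; rewrite ffunE -scalerAr linearZ /= pairingC.
Qed.

Lemma gen_mul_blade i T : gen i * blade T =
  if i \in T then 0 else (-1) ^+ inversions [set i] T *: blade (i |: T).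
Proof.
apply/ffunP => U; rewrite gen_mulE; case: ifP => iU.
  rewrite blade_neq; case: eqP => [<-|neT].
    by rewrite !inE eqxx /= setD1K // !ffunE eqxx.
  case: ifP => iT; first by rewrite ffunE mulr0.
  rewrite !ffunE; case: eqP => [eU|_]; last by rewrite mulr0 [_ *: _]mulr0.
  by case: neT; rewrite eU setU1K ?iT.
case: ifP => iT; rewrite !ffunE //; case: eqP => [eU|_].
  by rewrite eU setU11 in iU.
by rewrite [_ *: _]mulr0.
Qed.

Lemma contraction_genE i Y T : contraction (gen i) Y T =
  if i \in T then 0 else (-1) ^+ inversions [set i] T * Y (i |: T).
Proof.
rewrite ffunE gen_mul_blade pairingC; case: ifP => _.
  by rewrite [LHS]big1 // => S _; rewrite ffunE mulr0.
rewrite /pairing (bigD1 (i |: T)) //= !ffunE eqxx big1 ?addr0.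
  by rewrite [_ *: _]mulr1 mulrC.
by move=> S /negPf nS; rewrite !ffunE nS [_ *: _]mulr0 mulr0.
Qed.

Lemma contraction_gen_mul i j B : contraction (gen i) (gen j * B) =
  (i == j)%:R *: B - gen j * contraction (gen i) B.
Proof.
apply/ffunP => T; rewrite [RHS]ffunE [X in X + _]ffunE [X in _ + X]ffunE.
rewrite contraction_genE !gen_mulE contraction_genE.
have [<-{j}|neij] := eqVneq i j.
  rewrite setU11 !inE eqxx scale1r; case: ifP => iT /=.
    by rewrite setD1K // signrMK subrr.
  by rewrite setU1K ?iT // signrMK subr0.
rewrite scale0r add0r !inE eq_sym (negPf neij) /=.
case: (boolP (j \in T)) => [jT|_]; last by rewrite oppr0 mulr0 if_same.
case: (boolP (i \in T)) => iT; first by rewrite mulr0 oppr0.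
have -> : (i |: T) :\ j = i |: (T :\ j).
  apply/setP => k; rewrite !inE; case: (eqVneq k i) => [->|//].
  by rewrite neij.
rewrite (inversions1D i jT) (@inversions1D j i (i |: (T :\ j))) ?setU11 //.
rewrite setU1K ?inE ?(negPf iT) ?andbF //.
rewrite !mulrA -!exprD -mulNr -[- (_ ^+ _)]mulN1r -exprS; congr (_ * _).
rewrite -[LHS]signr_odd -[RHS]signr_odd; congr (_ ^+ _).
rewrite -(inj_eq val_inj) /= in neij.
case: (ltngtP i j) neij => //= _ _; rewrite ?oddD /=; by do 2!case: (odd _).
Qed.

Lemma contraction_is_linear A : linear (contraction A).
Proof.
by move=> a B C; apply/ffunP => S; rewrite !ffunE linearP.
Qed.

HB.instance Definition _ A :=
  GRing.isLinear.Build K (grassmann K n) (grassmann K n) *:%R (contraction A)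
    (@contraction_is_linear A).

Lemma contraction_gvec (a : 'I_n -> K) Y :
  contraction (gvec a) Y = \sum_i a i *: contraction (gen i) Y.
Proof.
apply/ffunP => S; rewrite ffunE sum_ffunE pairingC mulr_suml linear_sum.
by apply: eq_bigr => i _; rewrite !ffunE -scalerAl linearZ /= pairingC.
Qed.

Lemma contraction_gen_gvec_mul i (b : 'I_n -> K) B :
  contraction (gen i) (gvec b * B) =
  b i *: B - gvec b * contraction (gen i) B.
Proof.
rewrite mulr_suml linear_sum /gvec [in RHS]mulr_suml -sumrN.
have -> : b i *: B = \sum_j (b j *: ((i == j)%:R *: B)).
  rewrite (bigD1 i) //= eqxx scale1r big1 ?addr0 // => j /negPf neji.
  by rewrite eq_sym neji scale0r scaler0.
rewrite -big_split; apply: eq_bigr => j _ /=.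
by rewrite -scalerAl linearZ /= contraction_gen_mul scalerBr scalerAl.
Qed.

Lemma contraction_gvec_mul (a b : 'I_n -> K) B :
  contraction (gvec a) (gvec b * B) =
  (\sum_i a i * b i) *: B - gvec b * contraction (gvec a) B.
Proof.
rewrite !contraction_gvec.
under eq_bigr => i _ do rewrite contraction_gen_gvec_mul scalerBr scalerA.
rewrite sumrB scaler_suml mulr_sumr; congr (_ - _).
by apply: eq_bigr => i _; rewrite -scalerAr.
Qed.

Lemma gen_sq i : gen i * gen i = 0.
Proof. by rewrite gen_mul_blade set11. Qed.

Lemma gen_anti i j : gen i * gen j = - (gen j * gen i).
Proof.
have [->|neij] := eqVneq i j; first by rewrite gen_sq oppr0.
rewrite !gen_mul_blade !inE [j == i]eq_sym (negPf neij) !inversions1 setUC.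
rewrite -scaleNr; congr (_ *: _); rewrite -(inj_eq val_inj) /= in neij.
by case: (ltngtP i j) neij => //=; rewrite ?expr0 ?expr1 ?opprK.
Qed.

Lemma gen_gvec_anti i (a : 'I_n -> K) : gen i * gvec a = - (gvec a * gen i).
Proof.
rewrite mulr_sumr mulr_suml -sumrN; apply: eq_bigr => j _.
by rewrite -scalerAr gen_anti scalerN scalerAl.
Qed.

Lemma gvec_anti (a b : 'I_n -> K) : gvec a * gvec b = - (gvec b * gvec a).
Proof.
rewrite mulr_suml mulr_sumr -sumrN; apply: eq_bigr => i _.
by rewrite -scalerAl gen_gvec_anti scalerN scalerAr.
Qed.

Lemma gvec_sq (a : 'I_n -> K) : gvec a * gvec a = 0.
Proof.
rewrite /gvec; elim: (index_enum _) => [|i r IHr]; rewrite ?big_nil ?mul0r //.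
rewrite big_cons mulrDl !mulrDr IHr addr0 -scalerAl -scalerAr gen_sq !scaler0.
rewrite add0r mulr_sumr mulr_suml -big_split big1 // => j _ /=.
rewrite -!scalerAl -!scalerAr [X in X + _]scalerA [X in _ + X]scalerA mulrC.
by rewrite -scalerDr gen_anti addNr scaler0.
Qed.

Lemma sorted_enum_set S : sorted (fun i j : 'I_n => (i < j)%N) (enum S).
Proof.
have -> : enum S = [seq i <- enum 'I_n | i \in S] by rewrite enumT.
apply: sorted_filter; first by move=> i j k; apply: ltn_trans.
by have := iota_ltn_sorted 0 n; rewrite -val_enum_ord sorted_map.
Qed.

Lemma blade_prod S : blade S = \prod_(i <- enum S) gen i.
Proof.
rewrite -{1}(set_enum S); have := sorted_enum_set S.
elim: (enum S) => [_|i r IHr /= pir].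
  by rewrite big_nil; congr blade; apply/setP => i; rewrite !inE.
rewrite big_cons -IHr ?(path_sorted pir) // gen_mul_blade.
have lt_i : all (fun j : 'I_n => (i < j)%N) r.
  by apply: order_path_min pir => a b c; apply: ltn_trans.
have -> : inversions [set i] [set j in r] = 0%N.
  rewrite /inversions big_set1 big1 // => j; rewrite inE => jr.
  by rewrite ltnNge ltnW ?(allP lt_i).
rewrite inE; case: ifP => [/(allP lt_i)|_]; first by rewrite ltnn.
by rewrite expr0 scale1r; congr blade; apply/setP => j; rewrite !inE.
Qed.

Lemma contraction1 (a : 'I_n -> K) : contraction (gvec a) 1 = 0.
Proof.
rewrite contraction_gvec big1 // => i _; apply/ffunP => S.
rewrite [LHS](_ : _ = a i * contraction (gen i) 1 S); last by rewrite ffunE.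
rewrite contraction_genE ffunE; case: ifP => _; first by rewrite mulr0 ffunE.
have /negPf-> : i |: S != set0 by apply/set0Pn; exists i; apply: setU11.
by rewrite !mulr0 ffunE.
Qed.

Lemma pairing1 : pairing 1 1 = 1.
Proof. by rewrite pairing_blade ffunE eqxx. Qed.

Lemma contraction_prod (a : 'I_n -> K) k (b : 'I_k.+1 -> 'I_n -> K) :
  contraction (gvec a) (\prod_j gvec (b j)) =
  \sum_(j < k.+1) ((-1) ^+ j * \sum_i a i * b j i) *:
    \prod_(l < k) gvec (b (lift j l)).
Proof.
elim: k b => [|k IHk] b; rewrite big_ord_recl contraction_gvec_mul.
  by rewrite !big_ord0 contraction1 mulr0 subr0 big_ord1 big_ord0 expr0 mul1r.
rewrite [RHS]big_ord_recl expr0 mul1r; congr (_ + _).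
rewrite IHk mulr_sumr -sumrN; apply: eq_bigr => j _.
rewrite -scalerAr -scaleNr -mulNr -[- (_ ^+ _)]mulN1r -exprS.
congr (_ *: _); rewrite big_ord_recl; congr (gvec (b _) * _).
  by apply: val_inj.
apply: eq_bigr => l _; congr (gvec (b _)); apply: val_inj => /=.
by rewrite /bump /= !add1n ltnS; case: (j <= l)%N.
Qed.

Lemma pairing_prod m (a b : 'I_m -> 'I_n -> K) :
  pairing (\prod_i gvec (a i)) (\prod_j gvec (b j)) =
  \det (\matrix_(i, j) \sum_l a i l * b j l).
Proof.
elim: m a b => [|m IHm] a b; first by rewrite !big_ord0 pairing1 det_mx00.
rewrite [X in pairing X _]big_ord_recl -pairing_contraction contraction_prod.
rewrite linear_sum (expand_det_row _ ord0); apply: eq_bigr => j _.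
rewrite linearZ /= IHm [in RHS]mxE /cofactor add0n -mulrA mulrCA.
congr (_ * (_ * \det _)).
by apply/matrixP => i l; rewrite !mxE.
Qed.

Lemma pairing_prod_neq m k (a : 'I_m -> 'I_n -> K) (b : 'I_k -> 'I_n -> K) :
  m != k -> pairing (\prod_i gvec (a i)) (\prod_j gvec (b j)) = 0.
Proof.
elim: m k a b => [|m IHm] [|k] // a b.
- rewrite [X in pairing _ X]big_ord_recl pairingC -pairing_contraction.
  by rewrite !big_ord0 contraction1 linear0.
- rewrite [X in pairing X _]big_ord_recl -pairing_contraction.
  by rewrite [X in contraction _ X]big_ord0 contraction1 linear0.
rewrite eqSS => nemk.
rewrite [X in pairing X _]big_ord_recl -pairing_contraction contraction_prod.
by rewrite linear_sum big1 // => j _; rewrite linearZ /= IHm // mulr0.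
Qed.

(* The derivation of degree 0 extending the linear map e_i |-> gvec (c i):
   every factor of e_{i_1} /\ ... /\ e_{i_k} is replaced in turn. *)
Definition gder (c : 'I_n -> 'I_n -> K) A : grassmann K n :=
  \sum_S A S *: \sum_(i in S)
    \prod_(j <- enum S) (if j == i then gvec (c i) else gen j).

Lemma gderE (c : 'I_n -> 'I_n -> K) A :
  gder c A = \sum_i gvec (c i) * contraction (gen i) A.
Proof.
have deriv (r : seq 'I_n) : uniq r ->
  \sum_i gvec (c i) * contraction (gen i) (\prod_(j <- r) gen j) =
  \sum_(i <- r) \prod_(j <- r) (if j == i then gvec (c i) else gen j).
  elim: r => [_|k r IHr /= /andP[kr ur]].
    rewrite !big_nil big1 // => i _.
    have -> : gen i = gvec (fun j => (j == i)%:R).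
      rewrite /gvec (bigD1 i) //= eqxx scale1r big1 ?addr0 // => j /negPf->.
      exact: scale0r.
    by rewrite contraction1 mulr0.
  rewrite [RHS]big_cons !big_cons eqxx.
  under eq_bigr => i _ do rewrite contraction_gen_mul mulrBr -scalerAr.
  rewrite sumrB (bigD1 k) //= eqxx scale1r.
  rewrite [X in _ + X - _]big1 ?addr0; last first.
    by move=> i /negPf->; rewrite scale0r.
  congr (_ + _).
    congr (_ * _); rewrite big_seq [RHS]big_seq; apply: eq_bigr => j jr.
    by case: eqP => // ejk; rewrite -ejk jr in kr.
  rewrite [RHS]big_seq.
  under [RHS]eq_bigr => i ir.
    rewrite big_cons; case: eqP => [eki|_]; first by rewrite eki ir in kr.
    over.
  rewrite -[RHS]big_seq -mulr_sumr -IHr // mulr_sumr -sumrN.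
  by apply: eq_bigr => i _; rewrite !mulrA gen_gvec_anti mulNr.
rewrite [in RHS](grassmannE A).
under [RHS]eq_bigr => i _ do rewrite linear_sum mulr_sumr.
rewrite exchange_big; apply: eq_bigr => S _ /=.
rewrite -big_enum -deriv ?enum_uniq // -blade_prod scaler_sumr.
by apply: eq_bigr => i _; rewrite linearZ /= scalerAr.
Qed.

Lemma gder1 (c : 'I_n -> 'I_n -> K) : gder c 1 = 0.
Proof.
rewrite gderE big1 // => i _; have -> : contraction (gen i) 1 = 0.
  apply/ffunP => S; rewrite contraction_genE !ffunE; case: ifP => // _.
  have /negPf-> : i |: S != set0 by apply/set0Pn; exists i; apply: setU11.
  by rewrite mulr0.
by rewrite mulr0.
Qed.

Lemma gder_gvec_mul (c : 'I_n -> 'I_n -> K) (a : 'I_n -> K) B :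
  gder c (gvec a * B) =
  (\sum_i a i *: gvec (c i)) * B + gvec a * gder c B.
Proof.
rewrite !gderE [X in X + _]mulr_suml [X in _ + X]mulr_sumr -big_split.
apply: eq_bigr => i _ /=.
rewrite contraction_gen_gvec_mul mulrBr -scalerAr scalerAl; congr (_ + _).
by rewrite !mulrA [gvec (c i) * _]gvec_anti mulNr opprK.
Qed.

End Grassmann.

Arguments blade {K n} S.
Arguments gen {K n} i.

Section LieBracket.
Variables (K : fieldType) (L E : lmodType K).

Definition lie_bracket (br : L -> L -> L) : Prop :=
  [/\ forall y, linear (fun x => br x y),
      forall x, linear (br x),
      forall x, br x x = 0
    & forall x y z, br x (br y z) + br y (br z x) + br z (br x y) = 0].

Definition lie_representation (br : L -> L -> L) (rho : L -> E -> E) : Prop :=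
  [/\ lie_bracket br,
      forall a, linear (rho a),
      forall Y, linear (fun a => rho a Y)
    & forall a b Y, rho (br a b) Y = rho a (rho b Y) - rho b (rho a Y)].

End LieBracket.

Definition trace (K : fieldType) (W : vectType K) (f : W -> W) : K :=
  \sum_i coord (vbasis {:W}) i (f (vbasis {:W})`_i).

(* Both exterior algebras are described in coordinates: on [exterior V] the
   generators are the vectors of the basis [basis V] of V, on [exterior_dual V]
   they are the covectors of the dual basis [dual_basis V]. *)
Definition exterior (K : fieldType) (V : vectType K) : Type :=
  grassmann K (\dim {:V}).
Definition exterior_dual (K : fieldType) (V : vectType K) : Type :=
  grassmann K (\dim {:V}).

Section Dual.
Variables (K : fieldType) (V : vectType K).
Local Notation n := (\dim {:V}).

Definition dual : vectType K := 'Hom(V, K^o).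

Definition basis (i : 'I_n) : V := (vbasis {:V})`_i.

Definition dual_basis (i : 'I_n) : dual :=
  linfun (coord (vbasis {:V}) i : V -> K^o).

Definition ext_vec (x : V) : exterior V := gvec (dual_basis^~ x).

Definition ext_covec (xi : dual) : exterior_dual V :=
  gvec (fun i => xi (basis i)).

Definition vec_of_ext (Y : exterior V) : V := \sum_i Y [set i] *: basis i.

(* The extension of an endomorphism of V as a derivation of degree 0. *)
Definition ext_der (f : V -> V) : exterior V -> exterior V :=
  gder (fun i j => dual_basis j (f (basis i))).

Lemma dual_basisE i x : dual_basis i x = coord (vbasis {:V}) i x.
Proof. by rewrite lfunE. Qed.

Lemma basis_sum x : x = \sum_i dual_basis i x *: basis i.
Proof.
rewrite {1}(coord_vbasis (memvf x)).
by apply: eq_bigr => i _; rewrite dual_basisE.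
Qed.

(* With [pairing_prod], the determinant formula for the pairing. *)
Lemma coord_pairing (xi : dual) x :
  \sum_i xi (basis i) * dual_basis i x = xi x.
Proof.
rewrite [in RHS](basis_sum x) linear_sum.
by apply: eq_bigr => i _; rewrite linearZ mulrC.
Qed.

Lemma ext_vec_sq x : ext_vec x * ext_vec x = 0.
Proof. exact: gvec_sq. Qed.

Lemma ext_der1 f : ext_der f 1 = 0.
Proof. exact: gder1. Qed.

Lemma ext_der_mul (f : {linear V -> V}) x Y :
  ext_der f (ext_vec x * Y) = ext_vec (f x) * Y + ext_vec x * ext_der f Y.
Proof.
rewrite /ext_der gder_gvec_mul; congr (_ * _ + _).
rewrite {2}(basis_sum x) linear_sum /ext_vec /gvec.
under eq_bigr => i _ do rewrite scaler_sumr.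
rewrite exchange_big; apply: eq_bigr => j _ /=.
rewrite linear_sum scaler_suml; apply: eq_bigr => i _.
rewrite [f (_ *: _)]linearZ /= scalerA; congr (_ *: _); by rewrite [RHS]linearZ.
Qed.

Lemma ext_covec_dual_basis i : ext_covec (dual_basis i) = gen i.
Proof.
rewrite /ext_covec /gvec (bigD1 i) //= dual_basisE /basis.
rewrite coord_free ?(basis_free (vbasisP _)) // eqxx scale1r big1 ?addr0 //.
move=> j /negPf neji; rewrite dual_basisE coord_free ?(basis_free (vbasisP _)) //.
case: eqP => [eij|_]; last exact: scale0r.
by rewrite eij eqxx in neji.
Qed.

End Dual.

Section Tensors.
Variables (K : fieldType) (V : vectType K).
Local Notation n := (\dim {:V}).

(* The k-th tensor power of V, in the basis
   e_{t_1} (x) ... (x) e_{t_k} = [tensor_basis t]. *)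
Definition tensor (k : nat) : Type := {ffun k.-tuple 'I_n -> K^o}.

HB.instance Definition _ k := Vector.on (tensor k).

Definition tensor_basis k (t : k.-tuple 'I_n) : tensor k :=
  [ffun u => (u == t)%:R].

Definition tensor_mul k l (X : tensor k) (Y : tensor l) : tensor (k + l) :=
  \sum_t \sum_u (X t * Y u) *: tensor_basis [tuple of t ++ u].

Definition alt k (X : tensor k) : tensor k :=
  \sum_t X t *: \sum_(s : 'S_k)
    (-1) ^+ s *: tensor_basis [tuple tnth t (s i) | i < k].

(* The component of degree k of a multivector, viewed as a tensor through
   x_1 /\ ... /\ x_k = Alt (x_1 (x) ... (x) x_k). *)
Definition tensor_of k (Y : exterior V) : tensor k :=
  \sum_(t : k.-tuple 'I_n | sorted ltn (map val t))
    Y [set i in t] *: alt (tensor_basis t).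

(* gamma (x) 1 (x) ... (x) 1 *)
Definition tensor_cobracket k (gamma : V -> exterior V) (X : tensor k.+1) :
    tensor k.+2 :=
  \sum_(t : k.+1.-tuple 'I_n) X t *:
    tensor_mul (tensor_of 2 (gamma (basis (thead t))))
      (tensor_basis [tuple of behead t]).

End Tensors.

Section QuasiBialgebra.
Variables (K : fieldType) (V : vectType K).
Local Notation n := (\dim {:V}).

Variables (mu : V -> V -> V) (gamma : {linear V -> exterior V}).
Variable phi : exterior V.

Record lie_quasi_bialgebra : Prop := LieQuasiBialgebra {
  lqb_lie : lie_bracket mu;
  lqb_cobracket_degree : forall x, homogeneous 2 (gamma x);
  lqb_phi_degree : homogeneous 3 phi;
  lqb_cocycle : forall x y,
    gamma (mu x y) = ext_der (mu x) (gamma y) - ext_der (mu y) (gamma x);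
  lqb_co_jacobi : forall x,
    2^-1 *: alt (tensor_cobracket gamma (tensor_of 2 (gamma x))) =
    - tensor_of 3 (ext_der (mu x) phi);
  lqb_phi_cocycle : alt (tensor_cobracket gamma (tensor_of 3 phi)) = 0
}.

(* gamma (xi, eta) = ad^gamma_xi eta *)
Definition dual_bracket (xi eta : dual V) : dual V :=
  linfun (fun x => - pairing (ext_covec xi * ext_covec eta) (gamma x) : K^o).

(* ad^{mu *}_x xi *)
Definition coad_mu (x : V) (xi : dual V) : dual V :=
  linfun (fun y => - xi (mu x y)).

(* ad^{gamma *}_xi x *)
Definition coad_gamma (xi : dual V) (x : V) : V :=
  \sum_i - (dual_bracket xi (dual_basis i) x) *: basis i.

(* phi (xi, eta) = i_{xi /\ eta} phi *)
Definition phi_bracket (xi eta : dual V) : V :=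
  vec_of_ext (contraction (ext_covec xi * ext_covec eta) phi).

Definition lie_double : lmodType K := (V * dual V)%type.

(* The bracket of the double, with [xi, y] = - [y, xi]. *)
Definition double_bracket (a b : lie_double) : lie_double :=
  let: (x, xi) := a in let: (y, eta) := b in
  (mu x y - coad_gamma eta x + coad_gamma xi y + phi_bracket xi eta,
   coad_mu x eta - coad_mu y xi + dual_bracket xi eta).

Definition d_mu (xi : dual V) : exterior_dual V :=
  \sum_(i < n) \sum_(j < n | (i < j)%N)
    - (xi (mu (basis i) (basis j))) *: (gen i * gen j).

Definition d_gamma (x : V) : exterior V :=
  \sum_(i < n) \sum_(j < n | (i < j)%N)
    - (dual_bracket (dual_basis i) (dual_basis j) x) *: (gen i * gen j).

Lemma dual_bracketE (xi eta : dual V) x :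
  dual_bracket xi eta x = - pairing (ext_covec xi * ext_covec eta) (gamma x).
Proof.
pose f y : K^o := - pairing (ext_covec xi * ext_covec eta) (gamma y).
have lf : linear f by move=> a y z; rewrite /f linearP linearP opprD scalerN.
pose F := HB.pack_for {linear V -> K^o} f (GRing.isLinear.Build _ _ _ _ f lf).
exact: (lfunE F x).
Qed.

Lemma d_gammaE x : homogeneous 2 (gamma x) -> d_gamma x = gamma x.
Proof.
move=> hx; rewrite /d_gamma.
have E (i j : 'I_n) : (i < j)%N ->
    - (dual_bracket (dual_basis i) (dual_basis j) x) *: (gen i * gen j) =
    gamma x [set i; j] *: blade [set i; j].
  move=> ij; have gij : gen i * gen j = blade [set i; j] :> grassmann K n.
    rewrite gen_mul_blade inE -(inj_eq val_inj) /= (ltn_eqF ij) inversions1.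
    have -> : (j < i)%N = false by rewrite ltnNge ltnW.
    by rewrite expr0 scale1r.
  rewrite dual_bracketE opprK !ext_covec_dual_basis gij pairing_blade.
  congr (_ *: _); exact: gij.
under eq_bigr => i _ do under eq_bigr => j ij do rewrite E //.
apply/ffunP => T; rewrite sum_ffunE.
under eq_bigr => i _ do rewrite sum_ffunE.
have [/cards2P|nT] := boolP (#|T| == 2); last first.
  rewrite hx // big1 // => i _; rewrite big1 // => j ij.
  rewrite !ffunE; case: eqP => [eT|_]; last exact: mulr0.
  by rewrite eT cards2 -(inj_eq val_inj) /= (ltn_eqF ij) in nT.
move=> [a [b [neab ->{T}]]].
wlog ab : a b neab / (a < b)%N.
  move=> IH; rewrite -(inj_eq val_inj) /= in neab.
  by case: (ltngtP a b) neab => // h _; last rewrite setUC;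
     apply: IH => //; rewrite -(inj_eq val_inj) /= (ltn_eqF h).
rewrite (bigD1 a) //= (bigD1 b) //= !ffunE eqxx [_ *: _]mulr1.
rewrite big1 ?addr0 => [|j /andP[aj nejb]]; last first.
  rewrite !ffunE; case: eqP => [/setP/(_ j)|_]; last exact: mulr0.
  by rewrite !inE eqxx (negPf nejb) orbT orbF -(inj_eq val_inj) /= gtn_eqF.
rewrite big1 ?addr0 // => i neia; rewrite big1 // => j ij.
rewrite !ffunE; case: eqP => [eT|_]; last exact: mulr0.
have /setP/(_ i) := eT; rewrite !inE eqxx (negPf neia) /= => /eqP eib.
have /setP/(_ a) := eT.
rewrite !inE eqxx [a == i]eq_sym (negPf neia) /= => /esym/eqP eaj.
by move: ij; rewrite eib -eaj ltnNge ltnW.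
Qed.

(* The elements xi^mu and x^gamma. *)
Definition trace_mu : dual V := linfun (fun x => trace (mu x) : K^o).

Definition trace_gamma : V :=
  \sum_i trace (dual_bracket (dual_basis i)) *: basis i.

(* The operators R_x and R_xi. *)
Definition spin_vec (x : V) (Y : exterior V) : exterior V :=
  d_gamma x * Y + ext_der (mu x) Y - (2^-1 * trace_mu x) *: Y.

Definition spin_covec (xi : dual V) (Y : exterior V) : exterior V :=
  - contraction (d_mu xi) Y + ext_der (coad_gamma xi) Y
  - contraction (ext_covec xi) phi * Y + (2^-1 * xi trace_gamma) *: Y.

Definition spin (a : lie_double) (Y : exterior V) : exterior V :=
  spin_vec a.1 Y + spin_covec a.2 Y.

End QuasiBialgebra.

(* Main.v *)
From HB Require Import structures.
Require Import Defs.
From mathcomp Require Import all_boot all_algebra.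
From mathcomp Require Import reals.
From mathcomp Require Import perm ring.

Set Implicit Arguments.
Unset Strict Implicit.
Unset Printing Implicit Defensive.

(** The double D = V + V^* carries the symmetric form
    <x + xi, y + eta> = xi(y) + eta(x), and its Clifford algebra acts on the
    exterior algebra of V: a vector acts by exterior multiplication, a covector
    by contraction ([clifford], [clifford_anticomm]).  Let e_k be a basis of D
    and e^k the dual basis for the form.  To a skew-adjoint endomorphism A of D
    belongs the quadratic element q(A) = 1/2 sum_k c(A e_k) c(e^k)
    ([quantize]), which satisfies [q(A), c(b)] = c(A b).  Applying this to the
    two Clifford factors of q(B) gives [q(A), q(B)] = q([A, B]) without any
    scalar correction ([quantize_comm]).

    The operators R_x and R_xi are exactly q(ad x) and q(ad xi)
    ([quantize_vec], [quantize_cov]): when the dual bases of V and V^* are put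
    together into a basis of D, half of the terms of q come in the wrong
    order, and reordering them produces the trace terms; the two components of
    the bracket that preserve V and V^* give the derivation, the others give
    multiplication by the cobracket and by i_xi phi and contraction with
    d_mu xi.  Therefore the operators represent D as soon as ad is a
    representation, that is, as soon as the bracket of D satisfies the Jacobi
    identity.

    For the Jacobi identity, the bracket of D is invariant under the form,
    since <[a, b], c> is a sum of cyclically symmetric terms
    ([dform_bracket]).  Pairing the Jacobi expression of a, b, c with d
    therefore gives, up to sign, the 4-form
    <[a, b], [c, d]> + <[b, c], [a, d]> + <[c, a], [b, d]>
    ([jacobi_form]), which is alternating, so that it suffices to evaluate it
    on vectors and covectors.  It is zero on four vectors because V is an
    isotropic subalgebra; otherwise it vanishes by the Jacobi identity of mu
    (one covector), the cocycle condition (two), the co-Jacobi condition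
    (three) and the condition on phi (four).

    The last two conditions are stated with alternated tensors.  They become
    identities in the exterior algebra because Alt of a tensor is the tensor
    of the exterior product of its factors ([altE]); they then say that
    D_gamma(gamma x) = - x . phi and D_gamma phi = 0, where
    D_gamma Y = sum_i gamma(e_i) /\ i_(e^i) Y ([cobracket_der]), and pairing
    with products of covectors turns this into identities for the bracket of
    V^* ([dual_bracket_jacobiator], [phi_closed]). *)

Import GRing.Theory.
Local Open Scope ring_scope.

(** * Contraction and degree in the exterior algebra *)

Section ExteriorAlgebra.
Variables (K : fieldType) (n : nat).
Implicit Types (S T : {set 'I_n}) (A B C Y : grassmann K n).

Lemma contraction_mul A B Y :
  contraction (A * B) Y = contraction B (contraction A Y).
Proof.
by apply/ffunP => S; rewrite !ffunE -mulrA -pairing_contraction.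
Qed.

Lemma contractionZDl (a : K) A B Y :
  contraction (a *: A + B) Y = a *: contraction A Y + contraction B Y.
Proof.
apply/ffunP => S; rewrite !ffunE mulrDl -scalerAl.
by rewrite pairingC linearP /= ![pairing Y _]pairingC.
Qed.

Lemma contraction0l Y : contraction 0 Y = 0.
Proof. by apply/ffunP => S; rewrite !ffunE mul0r pairingC linear0. Qed.

Lemma pairingNl A B : pairing (- A) B = - pairing A B.
Proof. by rewrite pairingC linearN /= pairingC. Qed.

Lemma contractionNl A Y : contraction (- A) Y = - contraction A Y.
Proof.
by rewrite -scaleN1r -[_ *: A]addr0 contractionZDl contraction0l addr0 scaleN1r.
Qed.

Lemma contraction_suml (I : finType) (P : pred I) (a : I -> K)
    (F : I -> grassmann K n) Y :
  contraction (\sum_(i | P i) a i *: F i) Y =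
  \sum_(i | P i) a i *: contraction (F i) Y.
Proof.
elim/big_rec2: _ => [|i A B _ <-]; first exact: contraction0l.
exact: contractionZDl.
Qed.

Lemma contraction_gvec_anti (a b : 'I_n -> K) Y :
  contraction (gvec a) (contraction (gvec b) Y) =
  - contraction (gvec b) (contraction (gvec a) Y).
Proof.
by rewrite -!contraction_mul gvec_anti contractionNl.
Qed.

Lemma gen_gvec i : gen i = gvec (fun j => (j == i)%:R) :> grassmann K n.
Proof.
rewrite /gvec (bigD1 i) //= eqxx scale1r big1 ?addr0 // => j /negPf->.
exact: scale0r.
Qed.

(** Each i in a blade e_T is removed by contraction and put back by
    multiplication with the same sign, so that every element of T counts
    once. *)
Lemma number_operator k A : homogeneous k A ->
  \sum_i gen i * contraction (gen i) A = k%:R *: A.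
Proof.
move=> hA; apply/ffunP => T; rewrite sum_ffunE [RHS]ffunE.
have [<-{k hA}|neT] := eqVneq #|T| k; last first.
  rewrite hA // [_ *: _]mulr0 big1 // => i _.
  rewrite gen_mulE; case: ifP => // iT; rewrite contraction_genE.
  by rewrite !inE eqxx /= setD1K // hA // !mulr0.
rewrite (bigID (mem T)) /= [X in _ + X]big1 ?addr0; last first.
  by move=> i /negPf niT; rewrite gen_mulE niT.
under eq_bigr => i iT.
  rewrite gen_mulE iT contraction_genE !inE eqxx /= setD1K // signrMK.
  over.
by rewrite sumr_const [RHS]mulr_natl.
Qed.

Lemma homogeneous_contraction_gen k i A :
  homogeneous k.+1 A -> homogeneous k (contraction (gen i) A).
Proof.
move=> hA S neS; rewrite contraction_genE; case: ifP => // /negbT iS.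
by rewrite hA ?mulr0 // cardsU1 iS.
Qed.

Lemma homogeneous_gvec_mul k (a : 'I_n -> K) A :
  homogeneous k A -> homogeneous k.+1 (gvec a * A).
Proof.
move=> hA S neS; rewrite mulr_suml sum_ffunE big1 // => i _.
rewrite -scalerAl ffunE gen_mulE; case: ifP => iS; last exact: mulr0.
rewrite hA ?mulr0 ?[_ *: _]mulr0 //; apply: contraNneq neS => <-.
by rewrite [in X in X == _](cardsD1 i) iS.
Qed.

Lemma homogeneous1 : homogeneous 0 (1 : grassmann K n).
Proof. by move=> S /negPf neS; rewrite ffunE -cards_eq0 neS. Qed.

Lemma homogeneous_gvec (a : 'I_n -> K) : homogeneous 1 (gvec a).
Proof.
by rewrite -[gvec a]mulr1; apply: homogeneous_gvec_mul; apply: homogeneous1.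
Qed.

Lemma homogeneous0E A : homogeneous 0 A -> A = A set0 *: (1 : grassmann K n).
Proof.
move=> hA; apply/ffunP => S; rewrite !ffunE.
have [->|neS] := eqVneq S set0; first by rewrite [_ *: _]mulr1.
by rewrite (hA S) ?cards_eq0 // [_ *: _]mulr0.
Qed.

(** Since the blades of degree k are products of k generators, a property that
    is stable under linear combinations need only be checked on such
    products. *)
Lemma homogeneous_ind k (P : grassmann K n -> Prop) :
  P 0 -> (forall a A B, P A -> P B -> P (a *: A + B)) ->
  (forall r : seq 'I_n, size r = k -> P (\prod_(i <- r) gen i)) ->
  forall A, homogeneous k A -> P A.
Proof.
move=> P0 PD Pr A hA; rewrite (grassmannE A).
elim/big_rec: _ => // S B _ PB; have [eS|neS] := eqVneq #|S| k.
  by apply: PD => //; rewrite blade_prod; apply: Pr; rewrite -cardE.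
by rewrite hA // scale0r add0r.
Qed.

Lemma pairing_homogeneous k A Y (Z : grassmann K n) : homogeneous k A ->
  (forall S, #|S| = k -> Y S = Z S) -> pairing A Y = pairing A Z.
Proof.
move=> hA eYZ; apply: eq_bigr => S _.
have [eS|neS] := eqVneq #|S| k; first by rewrite eYZ.
by rewrite hA // !mul0r.
Qed.

End ExteriorAlgebra.

(** * Vectors, covectors and derivations *)

Section VectorsAndCovectors.
Variables (K : fieldType) (V : vectType K).
Local Notation n := (\dim {:V}).
Implicit Types (x y : V) (xi eta : dual V) (Y A B : exterior V).

Lemma dual_basis_basis i j : dual_basis i (basis j : V) = (i == j)%:R.
Proof.
rewrite dual_basisE coord_free ?(basis_free (vbasisP _)) //.
by rewrite eq_sym.
Qed.

Lemma dual_basis_sum xi : xi = \sum_i xi (basis i) *: dual_basis i.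
Proof.
apply/lfunP => x; rewrite {1}(basis_sum x) linear_sum sum_lfunE.
by apply: eq_bigr => i _; rewrite linearZ [RHS]lfunE /= [RHS]mulrC.
Qed.

Lemma ext_vec_is_linear : linear (@ext_vec K V).
Proof.
move=> a x y; rewrite /ext_vec /gvec scaler_sumr -big_split.
by apply: eq_bigr => i _; rewrite linearP /= scalerDl scalerA.
Qed.
HB.instance Definition _ := GRing.isLinear.Build K V (exterior V) *:%R
  (@ext_vec K V) ext_vec_is_linear.

Lemma ext_covec_is_linear : linear (@ext_covec K V).
Proof.
move=> a x y; rewrite /ext_covec /gvec scaler_sumr -big_split.
by apply: eq_bigr => i _; rewrite !lfunE /= lfunE scalerDl scalerA.
Qed.
HB.instance Definition _ := GRing.isLinear.Build K (dual V) (exterior_dual V)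
  *:%R (@ext_covec K V) ext_covec_is_linear.

Lemma ext_vec_basis i : ext_vec (basis i) = gen i :> exterior V.
Proof.
rewrite gen_gvec; apply: eq_bigr => j _; congr (_ *: _).
exact: dual_basis_basis.
Qed.

Lemma ext_vec_anti x y : ext_vec x * ext_vec y = - (ext_vec y * ext_vec x).
Proof. exact: gvec_anti. Qed.

Lemma contraction_ext_vec_mul xi x Y :
  contraction (ext_covec xi) (ext_vec x * Y) =
  xi x *: Y - ext_vec x * contraction (ext_covec xi) Y.
Proof. by rewrite contraction_gvec_mul coord_pairing. Qed.

Lemma contraction_ext_vec xi x :
  contraction (ext_covec xi) (ext_vec x) = xi x *: (1 : exterior V).
Proof.
by rewrite -[ext_vec x]mulr1 contraction_ext_vec_mul contraction1 mulr0 subr0.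
Qed.

Lemma contraction_ext_covec_anti xi eta Y :
  contraction (ext_covec xi) (contraction (ext_covec eta) Y) =
  - contraction (ext_covec eta) (contraction (ext_covec xi) Y).
Proof. exact: contraction_gvec_anti. Qed.

Lemma ext_covec_sum (I : finType) (a : I -> K) (f : I -> dual V) Y :
  contraction (ext_covec (\sum_i a i *: f i)) Y =
  \sum_i a i *: contraction (ext_covec (f i)) Y.
Proof.
rewrite linear_sum -contraction_suml; congr (contraction _ Y).
by apply: eq_bigr => i _; rewrite linearZ.
Qed.

Lemma ext_derE (f : V -> V) Y : ext_der f Y =
  \sum_i ext_vec (f (basis i)) * contraction (ext_covec (dual_basis i)) Y.
Proof.
by rewrite /ext_der gderE; apply: eq_bigr => i _; rewrite ext_covec_dual_basis.
Qed.

(** The operator f = sum_i f(e_i) (x) e^i is also sum_i e_i (x) f^t(e^i);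
    this writes the derivation of f through its transpose g. *)
Lemma ext_der_dual (f : V -> V) (g : dual V -> dual V) Y :
  (forall xi x, g xi x = xi (f x)) -> ext_der f Y =
  \sum_i ext_vec (basis i) * contraction (ext_covec (g (dual_basis i))) Y.
Proof.
move=> fg; rewrite ext_derE.
under eq_bigr => i _ do rewrite (basis_sum (f (basis i))) linear_sum mulr_suml.
rewrite exchange_big; apply: eq_bigr => j _ /=.
rewrite [g _]dual_basis_sum ext_covec_sum mulr_sumr; apply: eq_bigr => i _.
by rewrite fg linearZ /= -scalerAl -scalerAr.
Qed.

(** A derivation of degree 0 and a contraction commute up to the contraction
    by the transposed covector, as both are built from Clifford generators. *)
Lemma contraction_ext_der xi eta (f : V -> V) Y :
  (forall x, eta x = xi (f x)) ->
  contraction (ext_covec xi) (ext_der f Y) =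
  ext_der f (contraction (ext_covec xi) Y) + contraction (ext_covec eta) Y.
Proof.
move=> fE; rewrite !ext_derE linear_sum [eta]dual_basis_sum ext_covec_sum.
rewrite -big_split; apply: eq_bigr => i _ /=.
rewrite contraction_ext_vec_mul contraction_ext_covec_anti mulrN opprK addrC.
by rewrite fE.
Qed.

Lemma pairing_ext_der xi eta (f : V -> V) C Y :
  (forall x, eta x = xi (f x)) ->
  pairing (ext_covec xi * C) (ext_der f Y) =
  pairing C (ext_der f (contraction (ext_covec xi) Y)) +
  pairing (ext_covec eta * C) Y.
Proof.
move=> fE; rewrite -pairing_contraction (contraction_ext_der _ fE) linearD /=.
by rewrite pairing_contraction.
Qed.

Lemma pairing1_ext_der (f : V -> V) Y : pairing 1 (ext_der f Y) = 0.
Proof.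
rewrite pairing_blade ext_derE sum_ffunE big1 // => i _.
rewrite mulr_suml sum_ffunE big1 // => j _.
by rewrite -scalerAl ffunE gen_mulE in_set0 [_ *: _]mulr0.
Qed.

Lemma pairing_ext_vec xi x : pairing (ext_covec xi) (ext_vec x) = xi x.
Proof.
rewrite -[ext_covec xi]mulr1 -pairing_contraction contraction_ext_vec linearZ.
by rewrite /= pairing1 mulr1.
Qed.

Lemma vec_of_extE xi A : xi (vec_of_ext A) = pairing (ext_covec xi) A.
Proof.
rewrite pairingC !linear_sum; apply: eq_bigr => i _; rewrite !linearZ /=.
by rewrite pairingC pairing_blade mulrC.
Qed.

End VectorsAndCovectors.

(** * Alternation of tensors as exterior multiplication *)

Section TensorsAndMultivectors.
Variables (K : fieldType) (V : vectType K).
Local Notation n := (\dim {:V}).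
Implicit Types (Y A B : exterior V).

Definition wedge k (t : k.-tuple 'I_n) : exterior V := \prod_(i <- t) gen i.

(** The image of a tensor under the quotient map from the tensor algebra to
    the exterior algebra. *)
Definition tensor_ext k (X : tensor V k) : exterior V := \sum_t X t *: wedge t.

Lemma homogeneous_wedge k (t : k.-tuple 'I_n) : homogeneous k (wedge t).
Proof.
rewrite /wedge -{1}(size_tuple t); elim: (tval t) => [|i r IHr].
  by rewrite big_nil; apply: homogeneous1.
by rewrite big_cons gen_gvec; apply: homogeneous_gvec_mul.
Qed.

Lemma alt_basis k (u : k.-tuple 'I_n) :
  alt (tensor_basis u : tensor V k) = \sum_(s : 'S_k)
    (-1) ^+ s *: tensor_basis [tuple tnth u (s i) | i < k].
Proof.
rewrite /alt (bigD1 u) //= [X in _ + X]big1 ?addr0 => [|v /negPf nvu].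
  by rewrite ffunE eqxx scale1r.
by rewrite ffunE nvu scale0r.
Qed.

(** Both sides are the determinant of the Kronecker symbols of the indices of
    t and u, expanded over permutations. *)
Lemma pairing_wedge k (t u : k.-tuple 'I_n) :
  pairing (wedge t) (wedge u) = alt (tensor_basis u) t.
Proof.
rewrite /wedge !big_tuple.
under eq_bigr do rewrite gen_gvec.
under [in X in pairing _ X]eq_bigr do rewrite gen_gvec.
rewrite pairing_prod alt_basis sum_ffunE; apply: eq_bigr => s _.
rewrite !ffunE; congr (_ * _).
have -> : (t == [tuple tnth u (s i) | i < k]) =
    [forall i, tnth t i == tnth u (s i)].
  apply/eqP/forallP => [-> i|h]; first by rewrite tnth_mktuple.
  by apply: eq_from_tnth => i; rewrite tnth_mktuple; apply/eqP.
under eq_bigr => i _.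
  rewrite mxE (bigD1 (tnth t i)) //= eqxx mul1r big1 ?addr0; last first.
    by move=> l /negPf->; rewrite mul0r.
  over.
have [/forallP h|] := boolP [forall i, tnth t i == tnth u (s i)].
  by rewrite big1 // => i _; rewrite h.
rewrite negb_forall => /existsP[i /negPf ni].
by rewrite (bigD1 i) //= ni mul0r.
Qed.

Lemma pairing_neq_degree k l A B :
  homogeneous k A -> homogeneous l B -> k != l -> pairing A B = 0.
Proof.
move=> hA hB nekl; rewrite /pairing big1 // => S _.
have [eS|neS] := eqVneq #|S| k; last by rewrite hA // mul0r.
by rewrite (hB S) ?mulr0 // eS.
Qed.

Lemma homogeneous_blade (S : {set 'I_n}) :
  homogeneous #|S| (blade S : exterior V).
Proof.
by move=> T; rewrite blade_neq; case: (T =P S) => [->|//]; rewrite eqxx.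
Qed.

Lemma enum_sorted_tuple k (t : k.-tuple 'I_n) : sorted ltn (map val t) ->
  enum [set i in t] = t.
Proof.
move=> st; apply: (inj_map val_inj).
apply: (irr_sorted_eq ltn_trans ltnn) => //.
  by rewrite sorted_map; apply: sorted_enum_set.
by apply: eq_mem_map => i; rewrite mem_enum inE.
Qed.

Lemma blade_wedge k (t : k.-tuple 'I_n) : sorted ltn (map val t) ->
  wedge t = blade [set i in t].
Proof. by move=> st; rewrite blade_prod enum_sorted_tuple. Qed.

(** Sorted tuples of length k enumerate the blades of degree k, and the
    components of Y of other degrees do not contribute to the pairing. *)
Lemma tensor_ofE k Y (t : k.-tuple 'I_n) :
  tensor_of k Y t = pairing (wedge t) Y.
Proof.
rewrite {2}[Y]grassmannE linear_sum (bigID (fun S : {set 'I_n} => #|S| == k)).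
rewrite /= [X in _ = _ + X]big1 ?addr0 => [|S neS]; last first.
  rewrite linearZ /= (pairing_neq_degree (homogeneous_wedge t)
    (@homogeneous_blade S)) ?mulr0 // eq_sym //.
(* t serves as the default tuple for the sets that do not have k elements. *)
rewrite (reindex_onto (fun u : k.-tuple 'I_n => [set i in u])
  (fun S => insubd t (enum S))) /=; last first.
  move=> S /eqP eS; apply/setP => i; rewrite inE.
  by rewrite [i \in _](_ : _ = (i \in val (insubd t (enum S)))) // val_insubd
    -cardE eS eqxx mem_enum.
rewrite /tensor_of sum_ffunE; apply: eq_big => u.
  apply/idP/andP => [su|[/eqP eu /eqP <-]]; last first.
    rewrite val_insubd -cardE eu eqxx sorted_map; exact: sorted_enum_set.
  have eu := enum_sorted_tuple su; rewrite cardE eu size_tuple eqxx.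
  by split=> //; apply/eqP/val_inj; rewrite val_insubd size_tuple eqxx.
by move=> su; rewrite !ffunE -pairing_wedge -blade_wedge // linearZ.
Qed.

(** Alternating a tensor only remembers its class in the exterior algebra.
    This turns the tensor axioms of a Lie quasi-bialgebra into identities of
    multivectors. *)
Lemma altE k (X : tensor V k) : alt X = tensor_of k (tensor_ext X).
Proof.
apply/ffunP => t; rewrite tensor_ofE linear_sum sum_ffunE.
apply: eq_bigr => u _; rewrite linearZ /= ffunE pairing_wedge.
by rewrite alt_basis.
Qed.

(** The embedding of multivectors of degree k into tensors is injective,
    the coordinate of Y at a set S being that of its tensor at the enumeration
    of S; the pairing with a form C of degree k depends on nothing else. *)
Lemma tensor_of_inj k Y (Z : exterior V) : tensor_of k Y = tensor_of k Z ->
  forall C, homogeneous k C -> pairing C Y = pairing C Z.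
Proof.
move=> eYZ C hC; apply: (pairing_homogeneous hC) => S /eqP eS.
have eS' : size (enum S) == k by rewrite -cardE.
have := congr1 (fun X : tensor V k => X (Tuple eS')) eYZ.
by rewrite !tensor_ofE /wedge /= -blade_prod !pairing_blade.
Qed.

Lemma tensor_of_is_linear k : linear (@tensor_of K V k).
Proof.
by move=> a Y Z; apply/ffunP => t; rewrite !ffunE !tensor_ofE linearP.
Qed.
HB.instance Definition _ k := GRing.isLinear.Build K (exterior V) (tensor V k)
  *:%R (@tensor_of K V k) (@tensor_of_is_linear k).

Lemma tensor_ext_is_linear k : linear (@tensor_ext k).
Proof.
move=> a X Y; rewrite /tensor_ext scaler_sumr -big_split; apply: eq_bigr => t _.
by rewrite !ffunE scalerDl scalerA.
Qed.
HB.instance Definition _ k := GRing.isLinear.Build K (tensor V k) (exterior V)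
  *:%R (@tensor_ext k) (@tensor_ext_is_linear k).

Lemma tensor_ext_basis k (t : k.-tuple 'I_n) :
  tensor_ext (tensor_basis t) = wedge t.
Proof.
rewrite /tensor_ext (bigD1 t) //= ffunE eqxx scale1r big1 ?addr0 // => u.
by move=> /negPf ne; rewrite ffunE ne scale0r.
Qed.

Lemma tensor_ext_mul k l (X : tensor V k) (Y : tensor V l) :
  tensor_ext (tensor_mul X Y) = tensor_ext X * tensor_ext Y.
Proof.
rewrite linear_sum mulr_suml; apply: eq_bigr => t _.
rewrite linear_sum mulr_sumr; apply: eq_bigr => u _.
rewrite linearZ /= tensor_ext_basis /wedge big_cat /=.
by rewrite -scalerAl -scalerAr scalerA.
Qed.

Lemma big_tuple_cons (W : nmodType) (I : finType) k (F : k.+1.-tuple I -> W) :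
  \sum_t F t = \sum_i \sum_(u : k.-tuple I) F [tuple of i :: u].
Proof.
rewrite pair_bigA /=.
rewrite (reindex (fun p : I * k.-tuple I => [tuple of p.1 :: p.2])) //.
exists (fun t => (thead t, [tuple of behead t])) => [[i u] _|t _] /=.
  by congr (_, _); apply: val_inj.
by rewrite [RHS]tuple_eta.
Qed.

(** A decomposable multivector of degree k is embedded as a sum of k!
    tensors that all have it as their exterior product.  The induction strips
    one factor and counts degrees with [number_operator]. *)
Lemma tensor_ext_tensor_of k A : homogeneous k A ->
  tensor_ext (tensor_of k A) = k`!%:R *: A.
Proof.
elim: k A => [|k IHk] A hA.
  rewrite /tensor_ext (big_pred1 [tuple]) => [|t]; last first.
    by rewrite (tuple0 t) /= eqxx.
  rewrite tensor_ofE /wedge !big_nil pairing_blade fact0 scale1r.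
  exact/esym/homogeneous0E.
rewrite /tensor_ext big_tuple_cons.
transitivity (\sum_i gen i * (k`!%:R *: contraction (gen i) A)); last first.
  under eq_bigr => i _ do rewrite -scalerAr.
  by rewrite -scaler_sumr (number_operator hA) scalerA -natrM mulnC.
apply: eq_bigr => i _; rewrite -IHk; last exact: homogeneous_contraction_gen.
rewrite mulr_sumr; apply: eq_bigr => u _; rewrite !tensor_ofE /wedge big_cons.
by rewrite -pairing_contraction -scalerAr.
Qed.

(** The derivation of degree 1 of the exterior algebra that extends the
    cobracket; on x /\ y it is gamma(x) /\ y - x /\ gamma(y). *)
Definition cobracket_der (gamma : V -> exterior V) Y : exterior V :=
  \sum_i gamma (basis i) * contraction (gen i) Y.

(** The cobracket acts on the first factor of the tensor of Y, that is,
    on the factor split off by a contraction.  The factor 2 comes from embedding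
    gamma(e_i) as a tensor, and k! from embedding the contraction of Y. *)
Lemma tensor_ext_cobracket k (gamma : V -> exterior V) Y :
  (forall x, homogeneous 2 (gamma x)) -> homogeneous k.+1 Y ->
  tensor_ext (tensor_cobracket gamma (tensor_of k.+1 Y)) =
  (2 * k`!)%:R *: cobracket_der gamma Y.
Proof.
move=> hg hY; rewrite /tensor_cobracket big_tuple_cons linear_sum scaler_sumr.
apply: eq_bigr => i _; rewrite linear_sum /= natrM -scalerA.
rewrite [_ *: (_ * _)]scalerAr.
rewrite -tensor_ext_tensor_of; last exact: homogeneous_contraction_gen.
rewrite scalerAl -(tensor_ext_tensor_of (hg _)) mulr_sumr.
apply: eq_bigr => u _; rewrite linearZ /= (@tensor_ext_mul 2 k).
rewrite tensor_ext_basis theadE -scalerAr !tensor_ofE /wedge /= big_cons.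
by rewrite -pairing_contraction.
Qed.

End TensorsAndMultivectors.

(** * Pairing with products of covectors *)

Section PairingOfProducts.
Variables (K : fieldType) (V : vectType K).
Implicit Types (x y : V) (xi eta zeta theta : dual V) (A B C Y Z : exterior V).

Lemma pairing_covec_mul xi C Y :
  pairing (ext_covec xi * C) Y = pairing C (contraction (ext_covec xi) Y).
Proof. by rewrite pairing_contraction. Qed.

Lemma pairingB C Y Z : pairing C (Y - Z) = pairing C Y - pairing C Z.
Proof. exact: linearB. Qed.

Lemma pairingD C Y Z : pairing C (Y + Z) = pairing C Y + pairing C Z.
Proof. exact: linearD. Qed.

Lemma pairingZ C (a : K) Y : pairing C (a *: Y) = a * pairing C Y.
Proof. exact: linearZ. Qed.

Lemma contraction_vec_mul_vec xi x y :
  contraction (ext_covec xi) (ext_vec x * ext_vec y) =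
  xi x *: ext_vec y - xi y *: ext_vec x.
Proof.
by rewrite contraction_ext_vec_mul contraction_ext_vec -scalerAr mulr1.
Qed.

Lemma pairing_vec2 xi eta x y :
  pairing (ext_covec xi * ext_covec eta) (ext_vec x * ext_vec y) =
  xi x * eta y - xi y * eta x.
Proof.
rewrite pairing_covec_mul contraction_vec_mul_vec pairingB !pairingZ.
by rewrite !pairing_ext_vec.
Qed.

Lemma contraction_vec3 xi x y z :
  contraction (ext_covec xi) (ext_vec x * (ext_vec y * ext_vec z)) =
  xi x *: (ext_vec y * ext_vec z) - xi y *: (ext_vec x * ext_vec z)
  + xi z *: (ext_vec x * ext_vec y).
Proof.
rewrite contraction_ext_vec_mul contraction_vec_mul_vec mulrBr.
rewrite -(@scalerAr K _ (xi y)) -(@scalerAr K _ (xi z)).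
by rewrite opprB addrA addrAC.
Qed.

Lemma pairing_vec3 xi C x y z :
  pairing (ext_covec xi * C) (ext_vec x * (ext_vec y * ext_vec z)) =
  xi x * pairing C (ext_vec y * ext_vec z)
  - xi y * pairing C (ext_vec x * ext_vec z)
  + xi z * pairing C (ext_vec x * ext_vec y).
Proof.
by rewrite pairing_covec_mul contraction_vec3 pairingD pairingB !pairingZ.
Qed.

Lemma pairing_vec4 xi C x y z w :
  pairing (ext_covec xi * C)
    (ext_vec x * (ext_vec y * (ext_vec z * ext_vec w))) =
  xi x * pairing C (ext_vec y * (ext_vec z * ext_vec w))
  - xi y * pairing C (ext_vec x * (ext_vec z * ext_vec w))
  + xi z * pairing C (ext_vec x * (ext_vec y * ext_vec w))
  - xi w * pairing C (ext_vec x * (ext_vec y * ext_vec z)).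
Proof.
rewrite pairing_covec_mul contraction_ext_vec_mul contraction_vec3.
rewrite mulrDr mulrBr -(@scalerAr K _ (xi y)) -(@scalerAr K _ (xi z)).
rewrite -(@scalerAr K _ (xi w)).
rewrite pairingB pairingD pairingB !pairingZ.
do ![move: (pairing _ _) => ?]; move: (xi x) (xi y) (xi z) (xi w) => ? ? ? ?.
ring.
Qed.

(** When the pairs in s are the components of degree (k, l) of the coproduct of
    C, this is the duality of product and coproduct.  For the forms C used here
    the pairs are written out by hand, and it remains to check generators. *)
Lemma pairing_mul_homogeneous k l C (s : seq (exterior V * exterior V)) :
  (forall r q : seq 'I_(\dim {:V}), size r = k -> size q = l ->
    pairing C ((\prod_(i <- r) gen i) * \prod_(i <- q) gen i) =
    \sum_(p <- s) pairing p.1 (\prod_(i <- r) gen i) *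
      pairing p.2 (\prod_(i <- q) gen i)) ->
  forall A B, homogeneous k A -> homogeneous l B ->
  pairing C (A * B) = \sum_(p <- s) pairing p.1 A * pairing p.2 B.
Proof.
move=> CE A B hA hB; move: A hA.
apply: homogeneous_ind => [|a A A' IH IH'|r hr].
- rewrite mul0r linear0 big1_seq // => p _.
  by rewrite linear0 mul0r.
- rewrite mulrDl -scalerAl pairingD pairingZ IH IH' mulr_sumr -big_split.
  by apply: eq_bigr => p _; rewrite pairingD pairingZ mulrDl mulrA.
move: B hB; apply: homogeneous_ind => [|a B B' IH IH'|q hq].
- rewrite mulr0 linear0 big1_seq // => p _.
  by rewrite linear0 mulr0.
- rewrite mulrDr -scalerAr pairingD pairingZ IH IH' mulr_sumr -big_split.
  by apply: eq_bigr => p _; rewrite pairingD pairingZ mulrDr mulrCA.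
exact: CE.
Qed.

(** The three terms are the (2, 1)-shuffles of the covectors; the cyclic order
    absorbs the signs. *)
Lemma pairing_mul21 xi eta zeta A B : homogeneous 2 A -> homogeneous 1 B ->
  pairing (ext_covec xi * (ext_covec eta * ext_covec zeta)) (A * B) =
  pairing (ext_covec xi * ext_covec eta) A * pairing (ext_covec zeta) B +
  pairing (ext_covec eta * ext_covec zeta) A * pairing (ext_covec xi) B +
  pairing (ext_covec zeta * ext_covec xi) A * pairing (ext_covec eta) B.
Proof.
move=> hA hB; pose c := @ext_covec K V.
rewrite (pairing_mul_homogeneous (s := [:: (c xi * c eta, c zeta);
  (c eta * c zeta, c xi); (c zeta * c xi, c eta)]) _ hA hB).
  by rewrite !big_cons big_nil /= addr0 addrA.
move=> [|i [|j []]] // [|k []] // _ _; rewrite !big_cons !big_nil !mulr1 /=.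
rewrite -!ext_vec_basis /c -mulrA pairing_vec3 !pairing_vec2 !pairing_ext_vec.
do ![move: (_ (basis _)) => ?]; ring.
Qed.

(** The six terms are the (2, 2)-shuffles of the covectors; writing the pair
    (zeta, xi) in this order absorbs the sign. *)
Lemma pairing_mul22 xi eta zeta theta A B :
  homogeneous 2 A -> homogeneous 2 B ->
  pairing (ext_covec xi * (ext_covec eta * (ext_covec zeta * ext_covec theta)))
    (A * B) =
  pairing (ext_covec xi * ext_covec eta) A *
    pairing (ext_covec zeta * ext_covec theta) B +
  pairing (ext_covec eta * ext_covec zeta) A *
    pairing (ext_covec xi * ext_covec theta) B +
  pairing (ext_covec zeta * ext_covec xi) A *
    pairing (ext_covec eta * ext_covec theta) B +
  pairing (ext_covec zeta * ext_covec theta) A *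
    pairing (ext_covec xi * ext_covec eta) B +
  pairing (ext_covec xi * ext_covec theta) A *
    pairing (ext_covec eta * ext_covec zeta) B +
  pairing (ext_covec eta * ext_covec theta) A *
    pairing (ext_covec zeta * ext_covec xi) B.
Proof.
move=> hA hB; pose c := @ext_covec K V.
rewrite (pairing_mul_homogeneous (s := [:: (c xi * c eta, c zeta * c theta);
  (c eta * c zeta, c xi * c theta); (c zeta * c xi, c eta * c theta);
  (c zeta * c theta, c xi * c eta); (c xi * c theta, c eta * c zeta);
  (c eta * c theta, c zeta * c xi)]) _ hA hB).
  by rewrite !big_cons big_nil /= addr0 !addrA.
move=> [|i [|j []]] // [|k [|l []]] // _ _.
rewrite !big_cons !big_nil !mulr1 /= -!ext_vec_basis /c -mulrA.
rewrite pairing_vec4 !pairing_vec3 !pairing_vec2.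
do ![move: (_ (basis _)) => ?]; ring.
Qed.

Lemma pairing_ext_der2 xi eta xi' eta' (f : V -> V) Y :
  (forall x, xi' x = xi (f x)) -> (forall x, eta' x = eta (f x)) ->
  pairing (ext_covec xi * ext_covec eta) (ext_der f Y) =
  pairing (ext_covec xi' * ext_covec eta) Y +
  pairing (ext_covec xi * ext_covec eta') Y.
Proof.
move=> fx fe; rewrite (pairing_ext_der _ _ fx) -[ext_covec eta]mulr1.
rewrite (pairing_ext_der _ _ fe) pairing1_ext_der add0r mulr1 addrC.
by rewrite pairing_contraction mulr1.
Qed.

(** The action on multivectors is transposed to the action on each covector;
    the empty product contributes nothing, by [pairing1_ext_der]. *)
Lemma pairing_ext_der3 xi eta zeta xi' eta' zeta' (f : V -> V) Y :
  (forall x, xi' x = xi (f x)) -> (forall x, eta' x = eta (f x)) ->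
  (forall x, zeta' x = zeta (f x)) ->
  pairing (ext_covec xi * (ext_covec eta * ext_covec zeta)) (ext_der f Y) =
  pairing (ext_covec xi' * (ext_covec eta * ext_covec zeta)) Y +
  pairing (ext_covec xi * (ext_covec eta' * ext_covec zeta)) Y +
  pairing (ext_covec xi * (ext_covec eta * ext_covec zeta')) Y.
Proof.
move=> fx fe fz; rewrite (pairing_ext_der _ _ fx) (pairing_ext_der2 _ fe fz).
by rewrite !pairing_contraction addrC addrA.
Qed.

End PairingOfProducts.

(** * The structure maps of a Lie quasi-bialgebra *)

Section StructureMaps.
Variables (K : fieldType) (V : vectType K).
Variables (mu : V -> V -> V) (gamma : {linear V -> exterior V}).
Variable phi : exterior V.
Hypothesis hmu : lie_bracket mu.
Implicit Types (x y z w : V) (xi eta zeta theta : dual V).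

Local Notation br := (dual_bracket gamma).

Definition phi_form xi eta zeta : K :=
  pairing (ext_covec xi * (ext_covec eta * ext_covec zeta)) phi.
Local Notation tri := phi_form.

Lemma mu_linearr x : linear (mu x). Proof. by case: hmu. Qed.
Lemma mu_linearl y : linear (mu^~ y). Proof. by case: hmu. Qed.

Lemma mu_anti x y : mu x y = - mu y x.
Proof.
have [_ _ muxx _] := hmu.
have Dl u v t : mu (u + v) t = mu u t + mu v t.
  by have := mu_linearl t 1 u v; rewrite /= !scale1r.
have Dr u v t : mu t (u + v) = mu t u + mu t v.
  by have := mu_linearr t 1 u v; rewrite !scale1r.
have /eqP := muxx (x + y).
by rewrite Dl !Dr !muxx add0r addr0 addr_eq0 => /eqP.
Qed.

Lemma coad_muE x xi y : coad_mu mu x xi y = - xi (mu x y).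
Proof.
pose f z : K^o := - xi (mu x z).
have lf : linear f.
  by move=> a u v; rewrite /f mu_linearr linearP opprD scalerN.
pose F := HB.pack_for {linear V -> K^o} f (GRing.isLinear.Build _ _ _ _ f lf).
exact: (lfunE F y).
Qed.

Lemma dual_bracket_anti xi eta x : br xi eta x = - br eta xi x.
Proof.
by rewrite !dual_bracketE /ext_covec gvec_anti pairingNl !opprK.
Qed.

Lemma dual_bracketPl (a : K) xi eta zeta x :
  br (a *: xi + eta) zeta x = a * br xi zeta x + br eta zeta x.
Proof.
rewrite !dual_bracketE linearP mulrDl -scalerAl pairingC linearP /=.
by rewrite ![pairing (gamma x) _]pairingC opprD mulrN.
Qed.

(** In coordinates the coadjoint action is the contraction of the cobracket by
    xi, which makes it the transpose of the bracket of the dual. *)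
Lemma coad_gammaE xi eta x : eta (coad_gamma gamma xi x) = - br xi eta x.
Proof.
have -> : coad_gamma gamma xi x =
    vec_of_ext (contraction (ext_covec xi) (gamma x)).
  apply: eq_bigr => i _.
  by rewrite dual_bracketE opprK ffunE ext_covec_dual_basis.
by rewrite vec_of_extE pairing_contraction dual_bracketE opprK.
Qed.

Lemma phi_bracketE xi eta zeta :
  zeta (phi_bracket phi xi eta) = tri xi eta zeta.
Proof. by rewrite /tri vec_of_extE pairing_contraction mulrA. Qed.

Lemma tri_anti12 xi eta zeta : tri xi eta zeta = - tri eta xi zeta.
Proof.
rewrite /tri !mulrA [X in pairing (X * _) _]gvec_anti mulNr.
by rewrite pairingNl.
Qed.

Lemma tri_anti23 xi eta zeta : tri xi eta zeta = - tri xi zeta eta.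
Proof.
rewrite /tri [X in pairing (_ * X) _]gvec_anti mulrN.
by rewrite pairingNl.
Qed.

Lemma tri_cycle xi eta zeta : tri xi eta zeta = tri eta zeta xi.
Proof. by rewrite tri_anti12 tri_anti23 opprK. Qed.

(** Summing over a basis contracts the bracket of xi and eta, read off from the
    cobracket, into Y. *)
Lemma sum_cobracket_pairing xi eta C (Y : exterior V) :
  \sum_i pairing (ext_covec xi * ext_covec eta) (gamma (basis i)) *
    pairing C (contraction (gen i) Y) = - pairing (ext_covec (br xi eta) * C) Y.
Proof.
have -> : ext_covec (br xi eta) = \sum_i br xi eta (basis i) *: gen i by [].
rewrite [in RHS]mulr_suml [in RHS]pairingC.
rewrite linear_sum -sumrN; apply: eq_bigr => i _ /=.
rewrite -scalerAl pairingZ pairing_contraction.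
by rewrite [in RHS]pairingC dual_bracketE mulNr opprK.
Qed.

End StructureMaps.

(** * The axioms as identities for the bracket of the dual *)

Section StructureIdentities.
Variables (K : fieldType) (V : vectType K).
Variables (mu : V -> V -> V) (gamma : {linear V -> exterior V}).
Variable phi : exterior V.
Hypothesis two_neq0 : 2 != 0 :> K.
Hypothesis hG : lie_quasi_bialgebra mu gamma phi.
Implicit Types (x y z w : V) (xi eta zeta theta : dual V).
Implicit Types a b c d : lie_double V.

Local Notation br := (dual_bracket gamma).
Local Notation cm := (coad_mu mu).
Local Notation tri := (phi_form phi).

Lemma mu_jacobi x y z : mu x (mu y z) + mu y (mu z x) + mu z (mu x y) = 0.
Proof. by case: (lqb_lie hG). Qed.

(** The cocycle condition paired with xi /\ eta, with the adjoint action
    transposed to the covectors. *)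
Lemma dual_bracket_mu xi eta x y : br xi eta (mu x y) =
  br (cm y xi) eta x + br xi (cm y eta) x
  - br (cm x xi) eta y - br xi (cm x eta) y.
Proof.
have hmu := lqb_lie hG.
have tr z zeta v : (- cm z zeta) v = zeta (mu z v).
  by rewrite opp_lfunE coad_muE // opprK.
rewrite dual_bracketE (lqb_cocycle hG) pairingB.
rewrite !(pairing_ext_der2 _ (tr _ _) (tr _ _)) !linearN /=.
rewrite !(mulNr, mulrN, pairingNl) !dual_bracketE.
do ![move: (pairing _ _) => ?]; ring.
Qed.

(** The co-Jacobi condition in the exterior algebra.  The factor 1/2 cancels
    the 2 produced by the tensor of the cobracket. *)
Lemma pairing_cobracket_der xi eta zeta x :
  pairing (ext_covec xi * (ext_covec eta * ext_covec zeta))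
    (cobracket_der gamma (gamma x)) =
  - pairing (ext_covec xi * (ext_covec eta * ext_covec zeta))
    (ext_der (mu x) phi).
Proof.
rewrite -linearN /=; apply: (@tensor_of_inj _ _ 3); last first.
  by do 2!apply: homogeneous_gvec_mul; apply: homogeneous_gvec.
rewrite [RHS]linearN /= -(lqb_co_jacobi hG) altE tensor_ext_cobracket //.
- by rewrite linearZ /= scalerA mulVf // scale1r.
- exact: (lqb_cobracket_degree hG).
- exact: (lqb_cobracket_degree hG).
Qed.

(** The failure of the Jacobi identity on the dual is measured by the action
    of x on phi.  Expanding over shuffles the pairing of xi /\ eta /\ zeta with
    D_gamma(gamma x) gives the left-hand side. *)
Lemma dual_bracket_jacobiator xi eta zeta x :
  br (br xi eta) zeta x + br (br eta zeta) xi x + br (br zeta xi) eta x =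
  tri (cm x xi) eta zeta + tri xi (cm x eta) zeta + tri xi eta (cm x zeta).
Proof.
have hmu := lqb_lie hG; have hg := lqb_cobracket_degree hG.
have tr z theta v : (- cm z theta) v = theta (mu z v).
  by rewrite opp_lfunE coad_muE // opprK.
have := pairing_cobracket_der xi eta zeta x.
rewrite (pairing_ext_der3 _ (tr x xi) (tr x eta) (tr x zeta)).
rewrite !linearN /= !(mulNr, mulrN, pairingNl) -!opprD opprK => <-.
rewrite linear_sum /=.
under eq_bigr => i _.
  rewrite pairing_mul21; [over|exact: hg|exact: homogeneous_contraction_gen].
rewrite !big_split /= !sum_cobracket_pairing.
by rewrite -!dual_bracketE.
Qed.

(** This is the last axiom, D_gamma phi = 0, paired with the product of four
    covectors; the six terms are the shuffles of [pairing_mul22]. *)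
Lemma phi_closed xi eta zeta theta :
  tri (br xi eta) zeta theta + tri (br eta zeta) xi theta +
  tri (br zeta xi) eta theta + tri (br zeta theta) xi eta +
  tri (br xi theta) eta zeta + tri (br eta theta) zeta xi = 0.
Proof.
have hg := lqb_cobracket_degree hG; have hphi := lqb_phi_degree hG.
apply: oppr_inj; rewrite oppr0 !opprD.
have : pairing (ext_covec xi *
      (ext_covec eta * (ext_covec zeta * ext_covec theta)))
    (cobracket_der gamma phi) = 0.
  rewrite -[RHS](linear0 (pairing
    (ext_covec xi * (ext_covec eta * (ext_covec zeta * ext_covec theta))))).
  apply: (@tensor_of_inj _ _ 4); last first.
    by do 3!apply: homogeneous_gvec_mul; apply: homogeneous_gvec.
  have := lqb_phi_cocycle hG; rewrite altE tensor_ext_cobracket //.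
  rewrite linearZ linear0 => /eqP; rewrite scaler_eq0 natrM mulf_eq0 orbb.
  by rewrite (negPf two_neq0) => /eqP.
rewrite linear_sum /= => <-.
under [RHS]eq_bigr => i _.
  rewrite pairing_mul22; [over|exact: hg|exact: homogeneous_contraction_gen].
by rewrite !big_split /= !sum_cobracket_pairing.
Qed.

End StructureIdentities.

(** * The invariant form of the double *)

Section DoubleLieAlgebra.
Variables (K : fieldType) (V : vectType K).

Lemma dualN (xi : dual V) x : xi (- x) = - xi x. Proof. exact: linearN. Qed.

(** The hyperbolic form of V + V^*, for which V and V^* are isotropic. *)
Definition dform (a b : lie_double V) : K := a.2 b.1 + b.2 a.1.

Lemma dformC a b : dform a b = dform b a.
Proof. exact: addrC. Qed.

Lemma dformPl (k : K) (a b c : lie_double V) :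
  dform (k *: a + b) c = k * dform a c + dform b c.
Proof.
rewrite /dform /= linearP add_lfunE scale_lfunE /=.
by rewrite mulrDr addrACA.
Qed.

Lemma dformDl (a b c : lie_double V) : dform (a + b) c = dform a c + dform b c.
Proof. by rewrite -[a in LHS]scale1r dformPl mul1r. Qed.

Lemma dform0l (a : lie_double V) : dform 0 a = 0.
Proof. by rewrite /dform /= zero_lfunE linear0 addr0. Qed.

Lemma dform_inj (a b : lie_double V) :
  (forall c, dform a c = dform b c) -> a = b.
Proof.
case: a b => x xi [y eta] ab; congr (_, _); last first.
  by apply/lfunP => z; have := ab (z, 0); rewrite /dform /= !lfunE /= !addr0.
rewrite (basis_sum x) [RHS]basis_sum; apply: eq_bigr => i _.
by have := ab (0, dual_basis i); rewrite /dform /= !linear0 !add0r => ->.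
Qed.

Variables (mu : V -> V -> V) (gamma : {linear V -> exterior V}).
Variable phi : exterior V.
Hypothesis hmu : lie_bracket mu.
Implicit Types (x y z w : V) (xi eta zeta theta : dual V).
Implicit Types a b c d : lie_double V.

Local Notation br := (dual_bracket gamma).
Local Notation cm := (coad_mu mu).
Local Notation cg := (coad_gamma gamma).
Local Notation tri := (phi_form phi).
Local Notation "[[ a , b ]]" := (double_bracket mu gamma phi a b).

(** Every component of the bracket appears in all three cyclic positions.
    This is what fixes the mixed bracket of a vector and a covector, and it
    makes the invariance of the form visible. *)
Lemma dform_bracket a b c : dform [[a, b]] c =
  c.2 (mu a.1 b.1) + a.2 (mu b.1 c.1) + b.2 (mu c.1 a.1) +
  br a.2 b.2 c.1 + br b.2 c.2 a.1 + br c.2 a.2 b.1 + tri a.2 b.2 c.2.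
Proof.
case: a b c => x xi [y eta] [z zeta]; rewrite /dform /=.
rewrite !linearD linearN /= !coad_gammaE phi_bracketE.
rewrite !add_lfunE opp_lfunE !coad_muE // (dual_bracket_anti _ zeta).
rewrite (mu_anti hmu z x) dualN.
move: (tri _ _ _) (br _ _ _) (br _ _ _) (br _ _ _) => *.
by move: (zeta (mu _ _)) (xi (mu _ _)) (eta (mu _ _)) => *; ring.
Qed.

Lemma dform_bracket_anti a b c : dform [[a, b]] c = - dform [[b, a]] c.
Proof.
rewrite !dform_bracket (mu_anti hmu a.1 b.1) (mu_anti hmu b.1 c.1).
rewrite (mu_anti hmu c.1 a.1) (dual_bracket_anti _ a.2 b.2).
rewrite (dual_bracket_anti _ b.2 c.2) (dual_bracket_anti _ c.2 a.2).
rewrite (tri_anti12 _ a.2 b.2) !dualN.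
move: (tri _ _ _) (br _ _ _) (br _ _ _) (br _ _ _) => *.
by move: (a.2 (mu _ _)) (b.2 (mu _ _)) (c.2 (mu _ _)) => *; ring.
Qed.

(** Invariance of the form under the adjoint action, in cyclic form. *)
Lemma dform_bracket_cycle a b c : dform [[a, b]] c = dform [[b, c]] a.
Proof.
rewrite !dform_bracket tri_cycle.
move: (tri _ _ _) (br _ _ _) (br _ _ _) (br _ _ _) => *.
by move: (a.2 (mu _ _)) (b.2 (mu _ _)) (c.2 (mu _ _)) => *; ring.
Qed.

Lemma bracket_anti a b : [[a, b]] = - [[b, a]].
Proof.
apply: dform_inj => c; rewrite dform_bracket_anti.
by have := dformPl (-1) [[b, a]] 0 c; rewrite scaleN1r addr0 => ->;
   rewrite mulN1r /dform /= linear0 lfunE /= !addr0.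
Qed.

Lemma bracket_linearr a : linear (double_bracket mu gamma phi a).
Proof.
move=> k b c; apply: dform_inj => d.
rewrite dformPl !(dform_bracket_cycle a) !(dform_bracket_cycle _ d a).
by rewrite !(dformC [[d, a]]) dformPl.
Qed.

Lemma dformNl a b : dform (- a) b = - dform a b.
Proof. by rewrite /dform /= opp_lfunE dualN opprD. Qed.

Definition vecD x : lie_double V := (x, 0).
Definition covD xi : lie_double V := (0, xi).

Lemma double_split a : a = vecD a.1 + covD a.2.
Proof. by case: a => x xi; congr (_, _); rewrite /= ?addr0 ?add0r. Qed.

Lemma mu0l y : mu 0 y = 0.
Proof.
by have := mu_linearl hmu y (-1) 0 0; rewrite scaler0 addr0 scaleN1r addNr.
Qed.

Lemma mu0r x : mu x 0 = 0.
Proof. by rewrite (mu_anti hmu) mu0l oppr0. Qed.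

Lemma dual_bracket0l eta x : br 0 eta x = 0.
Proof. by rewrite dual_bracketE linear0 mul0r pairingC linear0 oppr0. Qed.

Lemma dual_bracket0 eta : br 0 eta = 0.
Proof. by apply/lfunP => x; rewrite dual_bracket0l zero_lfunE. Qed.

Lemma coad_mu0 x : cm x 0 = 0.
Proof. by apply/lfunP => y; rewrite coad_muE // !zero_lfunE oppr0. Qed.

Lemma coad_gamma0 x : cg 0 x = 0.
Proof.
by rewrite /coad_gamma big1 // => i _; rewrite dual_bracket0l oppr0 scale0r.
Qed.

Lemma phi_bracket0l eta : phi_bracket phi 0 eta = 0.
Proof.
rewrite /phi_bracket linear0 mul0r contraction0l /vec_of_ext big1 // => i _.
by rewrite ffunE scale0r.
Qed.

Lemma bracket_vv x y : [[vecD x, vecD y]] = vecD (mu x y).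
Proof.
rewrite /double_bracket /vecD /= !coad_gamma0 !coad_mu0 phi_bracket0l.
by rewrite dual_bracket0 !addr0 !subr0.
Qed.

Lemma bracket_vf x eta : [[vecD x, covD eta]] = (- cg eta x, cm x eta).
Proof.
rewrite /double_bracket /vecD /covD /= coad_gamma0 coad_mu0 phi_bracket0l.
by rewrite dual_bracket0 mu0r !addr0 subr0 add0r.
Qed.

Lemma bracket_fv xi y : [[covD xi, vecD y]] = (cg xi y, - cm y xi).
Proof. by rewrite bracket_anti bracket_vf; congr (_, _); rewrite opprK. Qed.

Lemma bracket_ff xi eta :
  [[covD xi, covD eta]] = (phi_bracket phi xi eta, br xi eta).
Proof.
have cg0 zeta : cg zeta 0 = 0.
  by rewrite /coad_gamma big1 // => i _; rewrite linear0 oppr0 scale0r.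
have cm0 zeta : cm 0 zeta = 0.
  by apply/lfunP => y; rewrite coad_muE // mu0l linear0 zero_lfunE oppr0.
by rewrite /double_bracket /covD /= mu0l !cg0 !cm0 !subr0 !add0r.
Qed.

Lemma bracketDr a b c : [[a, b + c]] = [[a, b]] + [[a, c]].
Proof. by have := bracket_linearr a 1 b c; rewrite !scale1r. Qed.

Lemma bracketNr a b : [[a, - b]] = - [[a, b]].
Proof.
apply: dform_inj => c.
rewrite dformNl !(dform_bracket_cycle a) !(dform_bracket_cycle _ c a).
by rewrite !(dformC [[c, a]]) dformNl.
Qed.

Lemma bracketDl a b c : [[a + b, c]] = [[a, c]] + [[b, c]].
Proof. by rewrite bracket_anti bracketDr opprD -!bracket_anti. Qed.

End DoubleLieAlgebra.

(** * The Jacobi identity of the double *)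

Section JacobiIdentity.
Variables (K : fieldType) (V : vectType K).
Variables (mu : V -> V -> V) (gamma : {linear V -> exterior V}).
Variable phi : exterior V.
Hypothesis two_neq0 : 2 != 0 :> K.
Hypothesis hG : lie_quasi_bialgebra mu gamma phi.
Implicit Types (x y z w : V) (xi eta zeta theta : dual V).
Implicit Types a b c d : lie_double V.

Local Notation br := (dual_bracket gamma).
Local Notation cm := (coad_mu mu).
Local Notation cg := (coad_gamma gamma).
Local Notation tri := (phi_form phi).
Local Notation "[[ a , b ]]" := (double_bracket mu gamma phi a b).
Let hmu := lqb_lie hG.

(** By invariance, this is up to sign the pairing of d with the Jacobi
    expression of a, b, c. *)
Definition jacobi_form a b c d :=
  dform [[a, b]] [[c, d]] + dform [[b, c]] [[a, d]] + dform [[c, a]] [[b, d]].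

Lemma jacobi_form_anti12 a b c d : jacobi_form b a c d = - jacobi_form a b c d.
Proof.
rewrite /jacobi_form (bracket_anti _ _ hmu b a) (bracket_anti _ _ hmu a c).
rewrite (bracket_anti _ _ hmu c b).
by rewrite !dformNl -!opprD addrAC.
Qed.

Lemma jacobi_form_cycle a b c d : jacobi_form b c a d = jacobi_form a b c d.
Proof. by rewrite /jacobi_form addrC addrA. Qed.

Lemma jacobi_form_anti34 a b c d : jacobi_form a b d c = - jacobi_form a b c d.
Proof.
rewrite /jacobi_form (bracket_anti _ _ hmu d c) (bracket_anti _ _ hmu d a).
rewrite (dformC [[a, b]]) !dformNl (dformC [[b, d]]) (bracket_anti _ _ hmu a c).
by rewrite dformNl (dformC [[c, d]]) (dformC [[a, d]]) -!opprD addrAC.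
Qed.

Lemma jacobi_formD a a' b c d :
  jacobi_form (a + a') b c d = jacobi_form a b c d + jacobi_form a' b c d.
Proof.
rewrite /jacobi_form !(bracketDl _ _ hmu) (bracketDr _ _ hmu) !dformDl.
rewrite (dformC [[b, c]]) dformDl.
rewrite !(dformC _ [[b, c]]).
by do ![move: (dform _ _) => ?]; ring.
Qed.

Lemma jacobi_form_last a b c d : jacobi_form d a b c = - jacobi_form a b c d.
Proof. by rewrite -jacobi_form_cycle -jacobi_form_anti34. Qed.

(** Together with the symmetries of the form, which bring any argument to the
    first place, this reduces its vanishing to vectors and covectors. *)
Lemma jacobi_form_split a b c d : jacobi_form (vecD a.1) b c d = 0 ->
  jacobi_form (covD a.2) b c d = 0 -> jacobi_form a b c d = 0.
Proof. by move=> av af; rewrite (double_split a) jacobi_formD av af addr0. Qed.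

(** Here the form reduces to the Jacobi identity of mu, evaluated on theta. *)
Lemma jacobi_form_vvvf x y z theta :
  jacobi_form (vecD x) (vecD y) (vecD z) (covD theta) = 0.
Proof.
rewrite /jacobi_form !(bracket_vv _ _ hmu) !(bracket_vf _ _ hmu) /dform /=.
rewrite !zero_lfunE !add0r.
rewrite !coad_muE //; apply: oppr_inj; rewrite oppr0.
have := congr1 theta (mu_jacobi hG x y z); rewrite !linearD linear0 /= => <-.
by do ![move: (theta _) => ?]; ring.
Qed.

(** Here the form reduces to the cocycle condition. *)
Lemma jacobi_form_ffvv xi eta x y :
  jacobi_form (covD xi) (covD eta) (vecD x) (vecD y) = 0.
Proof.
rewrite /jacobi_form (bracket_ff _ _ hmu) (bracket_vv _ _ hmu).
rewrite !(bracket_fv _ _ hmu) (bracket_vf _ _ hmu) /dform /=.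
rewrite zero_lfunE addr0 (dual_bracket_mu hG) !opp_lfunE !dualN !coad_gammaE.
rewrite (dual_bracket_anti _ eta (cm _ _)) (dual_bracket_anti _ eta (cm x _)).
do ![move: (br _ _ _) => ?]; ring.
Qed.

Lemma dform_ff_fv xi eta zeta x :
  dform [[covD xi, covD eta]] [[covD zeta, vecD x]] =
  br (br xi eta) zeta x - tri xi eta (cm x zeta).
Proof.
rewrite (bracket_ff _ _ hmu) (bracket_fv _ _ hmu) /dform /= opp_lfunE.
by rewrite coad_gammaE phi_bracketE -dual_bracket_anti.
Qed.

Lemma dform_ff_ff xi eta zeta theta :
  dform [[covD xi, covD eta]] [[covD zeta, covD theta]] =
  tri (br xi eta) zeta theta + tri (br zeta theta) xi eta.
Proof.
rewrite !(bracket_ff _ _ hmu) /dform /= !phi_bracketE.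
by rewrite -(tri_cycle _ (br xi eta)) -(tri_cycle _ (br zeta theta)).
Qed.

(** Here the form reduces to the co-Jacobi condition. *)
Lemma jacobi_form_fffv xi eta zeta x :
  jacobi_form (covD xi) (covD eta) (covD zeta) (vecD x) = 0.
Proof.
rewrite /jacobi_form (dform_ff_fv xi eta zeta) (dform_ff_fv eta).
rewrite (dform_ff_fv zeta).
have := dual_bracket_jacobiator two_neq0 hG xi eta zeta x.
rewrite (tri_cycle _ (cm x xi)) -(tri_cycle _ zeta xi (cm x eta)).
do 3![move: (br (br _ _) _ _) => ?]; do 3![move: (tri _ _ _) => ?].
by move/eqP; rewrite -subr_eq0 => /eqP <-; ring.
Qed.

(** Here the form reduces to the closedness of phi. *)
Lemma jacobi_form_ffff xi eta zeta theta :
  jacobi_form (covD xi) (covD eta) (covD zeta) (covD theta) = 0.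
Proof.
rewrite /jacobi_form (dform_ff_ff xi eta zeta) (dform_ff_ff eta).
rewrite (dform_ff_ff zeta).
rewrite -[RHS](phi_closed two_neq0 hG xi eta zeta theta).
by do 6![move: (tri _ _ _) => ?]; ring.
Qed.

Lemma jacobi_form_vvv a x y z : jacobi_form a (vecD x) (vecD y) (vecD z) = 0.
Proof.
apply: jacobi_form_split; last first.
  by rewrite jacobi_form_last jacobi_form_vvvf oppr0.
by rewrite /jacobi_form !(bracket_vv _ _ hmu) /dform /= !zero_lfunE !addr0.
Qed.

Lemma jacobi_form_vv a b x y : jacobi_form a b (vecD x) (vecD y) = 0.
Proof.
apply: jacobi_form_split.
  rewrite -jacobi_form_cycle jacobi_form_anti12 -jacobi_form_cycle.
  by rewrite jacobi_form_vvv oppr0.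
rewrite jacobi_form_anti12; apply/eqP; rewrite oppr_eq0; apply/eqP.
apply: jacobi_form_split; last exact: jacobi_form_ffvv.
by rewrite jacobi_form_anti12 jacobi_form_vvv oppr0.
Qed.

Lemma jacobi_form_v a b c x : jacobi_form a b c (vecD x) = 0.
Proof.
apply: jacobi_form_split; first by rewrite -jacobi_form_cycle jacobi_form_vv.
rewrite -2!jacobi_form_cycle; apply: jacobi_form_split.
  by rewrite -jacobi_form_cycle jacobi_form_vv.
rewrite -2!jacobi_form_cycle; apply: jacobi_form_split.
  by rewrite -jacobi_form_cycle jacobi_form_vv.
exact: jacobi_form_fffv.
Qed.

Lemma jacobi_form_eq0 a b c d : jacobi_form a b c d = 0.
Proof.
have vec_first x b' c' d' : jacobi_form (vecD x) b' c' d' = 0.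
  by rewrite jacobi_form_last jacobi_form_v oppr0.
apply: jacobi_form_split; rewrite ?vec_first // -jacobi_form_cycle.
apply: jacobi_form_split; rewrite ?vec_first // -jacobi_form_cycle.
apply: jacobi_form_split; rewrite ?vec_first //; apply: oppr_inj.
rewrite -jacobi_form_last oppr0.
apply: jacobi_form_split; rewrite ?vec_first //.
exact: jacobi_form_ffff.
Qed.

Lemma double_bracket_jacobi a b c :
  [[a, [[b, c]]]] + [[b, [[c, a]]]] + [[c, [[a, b]]]] = 0.
Proof.
apply: dform_inj => d.
(* Invariance moves one bracket to the other side of the form. *)
have E a' b' c' : dform [[a', [[b', c']]]] d = - dform [[b', c']] [[a', d]].
  rewrite 2!(dform_bracket_cycle _ _ hmu) (bracket_anti _ _ hmu d) dformNl.
  by rewrite dformC.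
rewrite !dformDl !E dform0l.
have := jacobi_form_eq0 a b c d; rewrite /jacobi_form.
do 3![move: (dform _ _) => ?] => e.
by rewrite -[RHS]oppr0 -e; ring.
Qed.

Lemma double_lie_bracket : lie_bracket (double_bracket mu gamma phi).
Proof.
split.
- move=> b k a c; rewrite !(bracket_anti _ _ hmu _ b) (bracket_linearr _ _ hmu).
  by rewrite opprD scalerN.
- exact: bracket_linearr.
- move=> a; apply: dform_inj => c; rewrite dform0l.
  have /eqP := dform_bracket_anti gamma phi hmu a a c.
  rewrite -addr_eq0 -mulr2n -mulr_natl mulf_eq0 (negPf two_neq0) /=.
  by move/eqP.
- exact: double_bracket_jacobi.
Qed.

End JacobiIdentity.

(** * Sums and traces *)

Lemma linear_sumZ (K : fieldType) (U W : lmodType K) (f : U -> W)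
    (I : finType) (a : I -> K) (u : I -> U) :
  linear f -> f (\sum_i a i *: u i) = \sum_i a i *: f (u i).
Proof.
move=> lf; elim/big_rec2: _ => [|i y x _ <-]; last exact: lf.
by have := lf (-1) 0 0; rewrite scaler0 addr0 scaleN1r addNr.
Qed.

Lemma sum_symmetric (W : nmodType) n (F : 'I_n -> 'I_n -> W) :
  (forall i j, F i j = F j i) -> (forall i, F i i = 0) ->
  \sum_i \sum_j F i j = (\sum_(i < n) \sum_(j < n | (i < j)%N) F i j) *+ 2.
Proof.
move=> symF diagF; rewrite mulr2n.
transitivity (\sum_(i < n) (\sum_(j < n | (i < j)%N) F i j +
                            \sum_(j < n | (j < i)%N) F i j)).
  apply: eq_bigr => i _; rewrite (bigID (fun j : 'I_n => (i < j)%N)) /=.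
  congr (_ + _); rewrite (bigID (fun j : 'I_n => (j < i)%N)) /=.
  rewrite [X in _ + X]big1 ?addr0 => [|j]; last first.
    by rewrite -!leqNgt => /anti_leq/val_inj ->.
  by apply: eq_bigl => j; rewrite -leqNgt ltn_neqAle; case: ltngtP.
rewrite big_split /=; congr (_ + _).
rewrite (exchange_big_dep predT) //=.
by apply: eq_bigr => i _; apply: eq_bigr => j _; apply: symF.
Qed.

Section Trace.
Variables (K : fieldType) (W : vectType K).

(** The trace can be computed in any basis, given with its coordinate functions.
    It is needed for endomorphisms of the dual of V, where the dual basis is
    the convenient one. *)
Lemma trace_dual_family (I : finType) (l : I -> W -> K^o) (w : I -> W)
    (f : W -> W) :
  linear f -> (forall i, linear (l i)) -> (forall v, v = \sum_i l i v *: w i) ->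
  trace f = \sum_i l i (f (w i)).
Proof.
move=> lf ll lw; rewrite /trace.
under eq_bigr => j _ do
  rewrite (lw (vbasis fullv)`_j) (linear_sumZ _ _ lf) linear_sum.
rewrite exchange_big; apply: eq_bigr => i _ /=.
rewrite [f (w i) in RHS](coord_vbasis (memvf _)) (linear_sumZ _ _ (ll i)).
by apply: eq_bigr => j _; rewrite linearZ /= mulrC.
Qed.

Lemma trace_is_linear (f g h : W -> W) (a : K) :
  (forall v, f v = a *: g v + h v) -> trace f = a * trace g + trace h.
Proof.
move=> fE; rewrite /trace mulr_sumr -big_split; apply: eq_bigr => i _.
by rewrite fE linearP.
Qed.

End Trace.

(** * Skew-adjoint operators as quadratic Clifford elements *)

Section CliffordAction.
Variables (K : fieldType) (V : vectType K).
Local Notation n := (\dim {:V}).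
Implicit Types (a b c d : lie_double V) (Y : exterior V).
Hypothesis two_neq0 : 2 != 0 :> K.

Definition clifford a Y : exterior V :=
  ext_vec a.1 * Y + contraction (ext_covec a.2) Y.

Lemma clifford_is_linear a : linear (clifford a).
Proof.
move=> k Y Z; rewrite /clifford linearP mulrDr -scalerAr scalerDr.
exact: addrACA.
Qed.
HB.instance Definition _ a := GRing.isLinear.Build K (exterior V) (exterior V)
  *:%R (clifford a) (@clifford_is_linear a).

Lemma cliffordDr a Y Z : clifford a (Y + Z) = clifford a Y + clifford a Z.
Proof. exact: linearD. Qed.

Lemma clifford_is_linearl Y : linear (clifford^~ Y).
Proof.
move=> k a b; rewrite /clifford /= !linearP /= mulrDl -scalerAl contractionZDl.
by rewrite scalerDr addrACA.
Qed.

(** The relation c(a) c(b) + c(b) c(a) = <a, b> of the Clifford algebra of the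
    double. *)
Lemma clifford_anticomm a b Y :
  clifford a (clifford b Y) = dform a b *: Y - clifford b (clifford a Y).
Proof.
rewrite /clifford !mulrDr !linearD /= !contraction_ext_vec_mul.
rewrite !mulrA (ext_vec_anti a.1) mulNr contraction_ext_covec_anti.
rewrite /dform scalerDl !opprD !opprK [X in _ = _ + (_ + X)]addrC !addrA.
(* The two opposite multiples of Y by b.2 a.1 are moved to the front. *)
rewrite [RHS](ACl (2*6*1*3*7*4*5)) /= subrr add0r.
by rewrite [LHS](ACl (3*1*2*4*5)).
Qed.

(** The basis of V followed by the dual basis of V^*. *)
Definition double_basis (k : 'I_n + 'I_n) : lie_double V :=
  match k with inl i => vecD (basis i) | inr i => covD (dual_basis i) end.

(** The dual basis of [double_basis] for the form, which exchanges the two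
    halves. *)
Definition double_dual_basis (k : 'I_n + 'I_n) : lie_double V :=
  match k with inl i => covD (dual_basis i) | inr i => vecD (basis i) end.

Lemma dform_is_linearl c : linear ((@dform K V)^~ c : lie_double V -> K^o).
Proof. by move=> k a b; rewrite /= dformPl. Qed.

Lemma dform_basisE a c :
  dform a c =
  \sum_k dform a (double_dual_basis k) * dform (double_basis k) c.
Proof.
rewrite big_sumType /= /dform /=.
under eq_bigr do rewrite !zero_lfunE linear0 !add0r mulrC.
under [X in _ = _ + X]eq_bigr do rewrite !zero_lfunE linear0 !addr0.
by rewrite !coord_pairing addrC.
Qed.

Lemma double_basis_sum a :
  a = \sum_k dform a (double_dual_basis k) *: double_basis k.
Proof.
apply: dform_inj => c.
by rewrite (linear_sumZ _ _ (dform_is_linearl c)) -dform_basisE.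
Qed.

Lemma double_dual_basis_sum a :
  a = \sum_k dform a (double_basis k) *: double_dual_basis k.
Proof.
apply: dform_inj => c.
rewrite (linear_sumZ _ _ (dform_is_linearl c)) dformC dform_basisE.
by apply: eq_bigr => k _; rewrite mulrC dformC (dformC c).
Qed.

(** The scalar part sum_k <A e_k, e^k> that distinguishes this from the
    antisymmetrised quadratic element vanishes for skew-adjoint A. *)
Definition quantize (A : lie_double V -> lie_double V) Y : exterior V :=
  2^-1 *: \sum_k clifford (A (double_basis k))
                          (clifford (double_dual_basis k) Y).

Definition skew_adjoint (A : lie_double V -> lie_double V) : Prop :=
  forall a b, dform (A a) b = - dform a (A b).

Lemma quantize_is_linear A : linear (quantize A).
Proof.
move=> k Y Z; rewrite /quantize scalerA mulrC -scalerA -scalerDr.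
congr (_ *: _).
rewrite scaler_sumr -big_split /=.
by apply: eq_bigr => i _; rewrite !linearP.
Qed.

(** Moving c(b) through c(A e_k) c(e^k) leaves <e^k, b> c(A e_k) and
    - <A e_k, b> c(e^k).  The first terms add up to c(A b), and so do the second
    ones because A is skew-adjoint, whence the factor 1/2 in q(A). *)
Lemma quantize_clifford A b Y : linear A -> skew_adjoint A ->
  quantize A (clifford b Y) = clifford (A b) Y + clifford b (quantize A Y).
Proof.
move=> lA sA.
have E1 : \sum_k dform (double_dual_basis k) b *:
    clifford (A (double_basis k)) Y = clifford (A b) Y.
  rewrite {2}(double_basis_sum b) (linear_sumZ _ _ lA).
  rewrite (linear_sumZ _ _ (clifford_is_linearl Y)).
  by apply: eq_bigr => k _; rewrite dformC.
have E2 : \sum_k dform (double_basis k) (A b) *: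
    clifford (double_dual_basis k) Y = clifford (A b) Y.
  rewrite [in RHS](double_dual_basis_sum (A b)).
  rewrite (linear_sumZ _ _ (clifford_is_linearl Y)).
  by apply: eq_bigr => k _; rewrite dformC.
rewrite /quantize [in RHS]linearZ /= [clifford b (\sum_k _)]linear_sum /=.
(* One copy of c(A b) comes from [E1], the other from [E2]. *)
have -> : clifford (A b) Y = 2^-1 *: (clifford (A b) Y + clifford (A b) Y).
  by rewrite -mulr2n -scaler_nat scalerA mulVf // scale1r.
rewrite -scalerDr -{1}E1 -E2 -!big_split /=; congr (_ *: _).
apply: eq_bigr => k _.
rewrite (clifford_anticomm _ b) linearB linearZ /= (clifford_anticomm _ b).
by rewrite opprB sA scaleNr opprK [X in _ + X]addrC addrA.
Qed.

(** The tensor sum_k e_k (x) e^k is invariant under skew-adjoint operators. *)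
Lemma quantize_transfer A B Y : linear A -> linear B -> skew_adjoint A ->
  \sum_k clifford (B (double_basis k)) (clifford (A (double_dual_basis k)) Y) =
  - \sum_k clifford (B (A (double_basis k))) (clifford (double_dual_basis k) Y).
Proof.
move=> lA lB sA.
have E k :
    clifford (B (double_basis k)) (clifford (A (double_dual_basis k)) Y) =
    \sum_l dform (A (double_dual_basis k)) (double_basis l) *:
      clifford (B (double_basis k)) (clifford (double_dual_basis l) Y).
  rewrite {1}[A (double_dual_basis k)]double_dual_basis_sum.
  rewrite (linear_sumZ _ _ (clifford_is_linearl Y)).
  exact: (linear_sumZ _ _ (@clifford_is_linear _)).
rewrite [LHS](eq_bigr _ (fun k _ => E k)) exchange_big -[RHS]sumrN.
apply: eq_bigr => l _ /=.
rewrite [A _ in RHS]double_basis_sum (linear_sumZ _ _ lB).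
rewrite (linear_sumZ _ _ (clifford_is_linearl _)) -sumrN.
by apply: eq_bigr => k _; rewrite sA dformC scaleNr.
Qed.

(** The commutator with q(A) is a derivation that acts on each c(b) through A;
    on q(B) it gives the sum over both factors, and [quantize_transfer] moves
    the second occurrence of A onto the first factor. *)
Lemma quantize_comm A B Y : linear A -> linear B -> skew_adjoint A ->
  quantize A (quantize B Y) =
  quantize B (quantize A Y) + quantize (fun c => A (B c) - B (A c)) Y.
Proof.
move=> lA lB sA; rewrite {2}/quantize scaler_sumr.
rewrite (linear_sumZ _ _ (quantize_is_linear A)) -scaler_sumr.
have E u v : quantize A (clifford u (clifford v Y)) =
    clifford (A u) (clifford v Y) + clifford u (clifford (A v) Y) +
    clifford u (clifford v (quantize A Y)).
  by rewrite 2!(quantize_clifford _ _ lA sA) cliffordDr addrA.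
rewrite (eq_bigr _ (fun k _ => E _ _)) 2!big_split /=.
rewrite [X in _ *: (_ + X + _)](quantize_transfer Y lA lB sA).
rewrite [X in _ *: X = _]addrC scalerDr; congr (_ + _).
rewrite /quantize -sumrB; congr (_ *: _); apply: eq_bigr => k _.
have := clifford_is_linearl (clifford (double_dual_basis k) Y) (-1)
  (B (A (double_basis k))) (A (B (double_basis k))).
by rewrite !scaleN1r [X in clifford X _]addrC => ->; rewrite addrC.
Qed.

Lemma quantizeD A A1 A2 (k : K) Y : (forall c, A c = k *: A1 c + A2 c) ->
  quantize A Y = k *: quantize A1 Y + quantize A2 Y.
Proof.
move=> AE; rewrite /quantize scalerA mulrC -scalerA -scalerDr; congr (_ *: _).
rewrite scaler_sumr -big_split; apply: eq_bigr => i _.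
by rewrite AE; apply: clifford_is_linearl.
Qed.

End CliffordAction.

(** * The spin representation of the double *)

Section SpinRepresentation.
Variables (K : fieldType) (V : vectType K).
Variables (mu : V -> V -> V) (gamma : {linear V -> exterior V}).
Variable phi : exterior V.
Hypothesis two_neq0 : 2 != 0 :> K.
Hypothesis hG : lie_quasi_bialgebra mu gamma phi.
Implicit Types (x y z : V) (xi eta : dual V) (Y : exterior V).
Implicit Types a b c : lie_double V.
Local Notation n := (\dim {:V}).
Local Notation br := (dual_bracket gamma).
Local Notation cm := (coad_mu mu).
Local Notation cg := (coad_gamma gamma).
Let hmu := lqb_lie hG.

Lemma trace_muE x : trace_mu mu x = trace (mu x).
Proof.
pose f z : K^o := trace (mu z).
have lf : linear f.
  move=> a u v; rewrite /f (@trace_is_linear _ _ _ (mu u) (mu v) a) // => w.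
  exact: (mu_linearl hmu).
pose F := HB.pack_for {linear V -> K^o} f (GRing.isLinear.Build _ _ _ _ f lf).
exact: (lfunE F x).
Qed.

Lemma sum_dual_basis_mu x :
  \sum_i dual_basis i (mu x (basis i)) = trace_mu mu x.
Proof.
by rewrite trace_muE; apply: eq_bigr => i _; rewrite dual_basisE.
Qed.

Lemma dual_bracket_linearr xi : linear (br xi).
Proof.
move=> a eta zeta; apply/lfunP => x; rewrite add_lfunE scale_lfunE.
rewrite !dual_bracketE linearP mulrDr -scalerAr pairingC linearP /=.
by rewrite ![pairing (gamma x) _]pairingC opprD scalerN.
Qed.

(** The covector xi enters linearly in its adjoint operator, and the trace is
    taken in the dual basis of V^*. *)
Lemma sum_dual_bracket_basis xi :
  \sum_i br xi (dual_basis i) (basis i) = xi (trace_gamma gamma).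
Proof.
rewrite linear_sum /=.
transitivity (trace (br xi)).
  rewrite (trace_dual_family (l := fun i (eta : dual V) => eta (basis i) : K^o)
    (w := @dual_basis K V) (dual_bracket_linearr xi)) //.
  - by move=> i a eta zeta; rewrite add_lfunE scale_lfunE.
  - exact: dual_basis_sum.
(* Linearity in the covector allows expanding xi in the dual basis. *)
have lt : linear (fun eta : dual V => trace (br eta) : K^o).
  move=> a eta zeta; rewrite (@trace_is_linear _ _ _ (br eta) (br zeta) a) //.
  by move=> theta; apply/lfunP => x; rewrite dual_bracketPl !lfunE /= !lfunE.
rewrite [in LHS](dual_basis_sum xi) (linear_sumZ _ _ lt).
by apply: eq_bigr => i _; rewrite [RHS]linearZ; apply: mulrC.
Qed.

Lemma ext_vec_of_ext (A : exterior V) :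
  homogeneous 1 A -> ext_vec (vec_of_ext A) = A.
Proof.
move=> hA; rewrite -[RHS]scale1r -(number_operator hA) linear_sum.
apply: eq_bigr => i _; rewrite linearZ /= ext_vec_basis.
rewrite [contraction _ _]homogeneous0E; last exact: homogeneous_contraction_gen.
rewrite contraction_genE in_set0 setU0 /inversions big_set1 big_set0 mul1r.
by rewrite -scalerAr mulr1.
Qed.

Lemma homogeneous_contraction_covec k xi (A : exterior V) :
  homogeneous k.+1 A -> homogeneous k (contraction (ext_covec xi) A).
Proof.
move=> hA S hS; rewrite contraction_gvec sum_ffunE big1 // => i _.
by rewrite ffunE (homogeneous_contraction_gen i hA) // [_ *: _]mulr0.
Qed.

(** Summing over all pairs of indices counts each pair i < j twice. *)
Lemma d_gamma_double x :
  \sum_i ext_vec (cg (dual_basis i) x) * gen i = - (d_gamma gamma x *+ 2).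
Proof.
transitivity (- \sum_i \sum_j
    - (br (dual_basis i) (dual_basis j) x) *: (gen i * gen j : exterior V)).
  rewrite -sumrN; apply: eq_bigr => i _.
  rewrite linear_sum mulr_suml -sumrN; apply: eq_bigr => j _.
  by rewrite linearZ /= ext_vec_basis -scalerAl [gen j * gen i]gen_anti scalerN.
congr (- _); apply: sum_symmetric => [i j|i].
  by rewrite [gen j * gen i]gen_anti dual_bracket_anti scalerN -scaleNr opprK.
by rewrite gen_sq scaler0.
Qed.

(** Contraction reverses products, and the sum over all pairs of indices
    counts each pair i < j twice. *)
Lemma d_mu_double xi Y :
  \sum_i contraction (ext_covec (cm (basis i) xi)) (contraction (gen i) Y) =
  contraction (d_mu mu xi) Y *+ 2.
Proof.
transitivity (\sum_i \sum_j
    - xi (mu (basis i) (basis j)) *: contraction (gen i * gen j) Y).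
  apply: eq_bigr => i _; rewrite contraction_gvec; apply: eq_bigr => j _.
  by rewrite coad_muE // contraction_mul.
rewrite sum_symmetric => [|i j|i].
- congr (_ *+ 2); rewrite /d_mu.
  have -> : \sum_(i < n) \sum_(j < n | (i < j)%N)
      - xi (mu (basis i) (basis j)) *: (gen i * gen j) =
    \sum_(i < n) 1 *: \sum_(j < n | (i < j)%N)
      - xi (mu (basis i) (basis j)) *: (gen i * gen j) :> exterior V.
    by apply: eq_bigr => i _; rewrite scale1r.
  rewrite contraction_suml; apply: eq_bigr => i _.
  by rewrite scale1r contraction_suml.
- rewrite (mu_anti hmu) dualN opprK [gen i * gen j]gen_anti contractionNl.
  by rewrite scalerN scaleNr.
have [_ _ -> _] := hmu; by rewrite linear0 oppr0 scale0r.
Qed.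

(** The contraction of phi by xi has degree 2, which is what the number operator
    counts. *)
Lemma phi_double xi :
  \sum_i ext_vec (phi_bracket phi xi (dual_basis i)) * gen i =
  - (contraction (ext_covec xi) phi *+ 2).
Proof.
have hw : homogeneous 2 (contraction (ext_covec xi) phi).
  exact: homogeneous_contraction_covec (lqb_phi_degree hG).
rewrite -scaler_nat -(number_operator hw) -sumrN; apply: eq_bigr => i _.
rewrite -ext_vec_basis ext_vec_anti ext_vec_basis; congr (- (_ * _)).
rewrite /phi_bracket contraction_mul ext_covec_dual_basis ext_vec_of_ext //.
exact: homogeneous_contraction_gen.
Qed.

Lemma quantizeE A Y : quantize A Y = 2^-1 *:
  (\sum_i clifford (A (vecD (basis i))) (contraction (gen i) Y) +
   \sum_i clifford (A (covD (dual_basis i))) (gen i * Y)).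
Proof.
rewrite /quantize big_sumType; congr (_ *: (_ + _)); apply: eq_bigr => i _.
  congr (clifford _ _); rewrite /clifford /= linear0 mul0r add0r.
  by rewrite ext_covec_dual_basis.
congr (clifford _ _); rewrite /clifford /= linear0 contraction0l addr0.
by rewrite ext_vec_basis.
Qed.

Lemma contraction_covec_basis_mul xi i Y :
  contraction (ext_covec xi) (gen i * Y) =
  xi (basis i) *: Y - gen i * contraction (ext_covec xi) Y.
Proof. by rewrite -ext_vec_basis contraction_ext_vec_mul. Qed.

Lemma half_double (W : lmodType K) (w : W) : 2^-1 *: (w *+ 2) = w.
Proof. by rewrite -scaler_nat scalerA mulVf // scale1r. Qed.

(** These terms of q have the covector on the left of the vector; bringing them
    to normal order produces the trace of f. *)
Lemma sum_contraction_transpose (f : V -> V) (g : dual V -> dual V) Y :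
  (forall xi x, g xi x = - xi (f x)) ->
  \sum_i contraction (ext_covec (g (dual_basis i))) (gen i * Y) =
  ext_der f Y - (\sum_i dual_basis i (f (basis i))) *: Y.
Proof.
move=> gE; have oppgE xi x : (- g xi) x = xi (f x).
  by rewrite opp_lfunE gE opprK.
rewrite (ext_der_dual _ oppgE) scaler_suml -sumrB; apply: eq_bigr => i _.
rewrite contraction_covec_basis_mul gE scaleNr addrC; congr (_ - _).
by rewrite linearN /= contractionNl mulrN ext_vec_basis.
Qed.

(** The derivation and the trace arise from both halves of the basis: once in
    normal order, and once after reordering, which explains the factor 1/2 of
    the trace. *)
Lemma quantize_vec x Y :
  quantize (double_bracket mu gamma phi (vecD x)) Y = spin_vec mu gamma x Y.
Proof.
rewrite quantizeE.
under eq_bigr do rewrite (bracket_vv _ _ hmu) /clifford /= linear0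
  contraction0l addr0 -ext_covec_dual_basis.
under [X in _ + X]eq_bigr do rewrite (bracket_vf _ _ hmu) /clifford /=.
rewrite -ext_derE big_split /=.
rewrite (sum_contraction_transpose (f := mu x)); last first.
  by move=> xi y; apply: coad_muE.
rewrite sum_dual_basis_mu.
have -> : \sum_i ext_vec (- cg (dual_basis i) x) * (gen i * Y) =
    (d_gamma gamma x * Y) *+ 2.
  rewrite -mulrnAl -[_ *+ 2]opprK -d_gamma_double mulNr mulr_suml -sumrN.
  by apply: eq_bigr => i _; rewrite linearN /= mulNr mulrA.
rewrite (addrA (_ *+ 2)) addrA (addrCA (ext_der _ _)) -mulr2n -mulrnDl.
by rewrite scalerBr half_double scalerA.
Qed.

(** As for vectors; the trace has the opposite sign because the coadjoint action
    of xi is minus the transpose of its adjoint action on V^*. *)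
Lemma quantize_cov xi Y :
  quantize (double_bracket mu gamma phi (covD xi)) Y =
  spin_covec mu gamma phi xi Y.
Proof.
rewrite quantizeE.
under eq_bigr do rewrite (bracket_fv _ _ hmu) /clifford /= linearN /=
  contractionNl.
under [X in _ + X]eq_bigr do rewrite (bracket_ff _ _ hmu) /clifford /= mulrA.
rewrite !big_split /= sumrN d_mu_double -mulr_suml phi_double.
rewrite (sum_contraction_transpose (f := cg xi)); last first.
  by move=> eta y; rewrite coad_gammaE opprK.
under eq_bigr do rewrite -ext_covec_dual_basis.
rewrite -ext_derE.
have -> : \sum_i dual_basis i (cg xi (basis i)) = - xi (trace_gamma gamma).
  rewrite -sum_dual_bracket_basis -sumrN; apply: eq_bigr => i _.
  exact: coad_gammaE.
rewrite mulNr mulrnAl scaleNr opprK /spin_covec -[in RHS]scalerA.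
rewrite -[X in _ = X + _]half_double -scalerDr; congr (_ *: _).
rewrite !mulrnDl !mulNrn [ext_der _ _ *+ 2]mulr2n !addrA.
by rewrite [LHS](ACl (2*1*4*3*5)).
Qed.

Lemma spinE a Y :
  spin mu gamma phi a Y = quantize (double_bracket mu gamma phi a) Y.
Proof.
rewrite /spin -quantize_vec -quantize_cov -[X in X + _]scale1r.
rewrite [quantize (double_bracket _ _ _ a) Y](quantizeD (k := 1)
  (A1 := double_bracket mu gamma phi (vecD a.1))
  (A2 := double_bracket mu gamma phi (covD a.2))) // => c.
by rewrite scale1r {1}[a](double_split a) (bracketDl _ _ hmu).
Qed.

(** By [spinE] the operators are q(ad a), so that their commutators follow from
    [quantize_comm] and the Jacobi identity of the double. *)
Lemma spin_representation :
  lie_representation (double_bracket mu gamma phi) (spin mu gamma phi).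
Proof.
have dl := double_lie_bracket two_neq0 hG; have [ll lr _ jac] := dl.
split=> //.
- by move=> a k Y Z; rewrite !spinE; apply: quantize_is_linear.
- move=> Y k a b; rewrite !spinE; apply: quantizeD => c; exact: ll.
have sk a : skew_adjoint (double_bracket mu gamma phi a).
  move=> b c; rewrite 2!(dform_bracket_cycle _ _ hmu) (bracket_anti _ _ hmu).
  by rewrite dformNl dformC.
move=> a b Y; rewrite !spinE (quantize_comm _ Y (lr a) (lr b) (sk a)) //.
rewrite addrC addKr /quantize; congr (_ *: _); apply: eq_bigr => k _.
congr (clifford _ _); rewrite (bracket_anti _ _ hmu (double_bracket _ _ _ a b)).
have /eqP := jac a b (double_basis k).
rewrite addr_eq0 => /eqP <-; congr (_ + _).
by rewrite (bracket_anti _ _ hmu (double_basis k)) (bracketNr _ _ hmu).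
Qed.

End SpinRepresentation.

Theorem theorem4p1 (R : realType) (k : scalar_kind)
    (V : vectType (scalars R k)) (mu : V -> V -> V)
    (gamma : {linear V -> exterior V}) (phi : exterior V)
    (hG : lie_quasi_bialgebra mu gamma phi) :
  lie_representation (double_bracket mu gamma phi) (spin mu gamma phi).
Proof.
by apply: spin_representation => //; rewrite Num.Theory.pnatr_eq0.
Qed.
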